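(* Let $G$ be a directed graph whose connected components are $\{\mathscr{C}_{n_\lambda}\}_{\lambda\in\Lambda}$, where each $\mathscr{C}_{n_\lambda}$ is the $n_\lambda$-circle graph for some $n_\lambda\geq1$. Then for every derivation $\delta$ on $\mathfrak{L}_G$, there exists $T\in\mathfrak{L}_G$ such that $\delta=\delta_T$ and $\|T\|\leq\|\delta\|$.
   Context: A directed graph $G=(\mathcal{V},\mathcal{E},s,r)$ has a vertex set $\mathcal{V}$ and an edge set $\mathcal{E}$ (each of arbitrary cardinality) and source and range maps $s,r\colon\mathcal{E}\to\mathcal{V}$; an edge $e$ is an arrow from $s(e)$ to $r(e)$. $\mathbb{F}_G^+$ is the set of all directed paths of finite length: vertices $v$ are paths of length $0$ with $r(v)=s(v)=v$, and a path of length $n\geq1$ is $p=e_1e_2\cdots e_n$ with $s(e_j)=r(e_{j+1})$, $r(p)=r(e_1)$, $s(p)=s(e_n)$; if $s(p_1)=r(p_2)$, the product $p_1p_2$ is the concatenation. Let $\mathcal{H}_G=\ell^2(\mathbb{F}_G^+)$ with orthonormal basis $\{\xi_w\}$. For $e\in\mathcal{E}$, $L_e\xi_w=\xi_{ew}$ if $r(w)=s(e)$ and $0$ otherwise; for $x\in\mathcal{V}$, $L_x\xi_w=\xi_w$ if $r(w)=x$ and $0$ otherwise. $\mathfrak{L}_G$ is the weak-operator closed algebra generated by $\{L_e,L_x\colon e\in\mathcal{E},x\in\mathcal{V}\}$ in $B(\mathcal{H}_G)$. A derivation on $\mathfrak{L}_G$ is a linear map $\delta\colon\mathfrak{L}_G\to\mathfrak{L}_G$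 (not assumed bounded) with $\delta(AB)=\delta(A)B+A\delta(B)$; $\delta_T(A)=AT-TA$. The $n$-circle graph $\mathscr{C}_n$ ($n\geq1$) has distinct vertices $v_1,\dots,v_n$ and edges $e_1,\dots,e_n$ with $r(e_j)=v_j$, $s(e_j)=v_{j+1\,(\mathrm{mod}\,n)}$. Connected components are those of the underlying undirected graph. *)

(* Defs.v *)
From HB Require Import structures.
From Stdlib Require Import Relation_Operators.
From mathcomp Require Import all_boot all_order all_algebra.
From mathcomp Require Import complex.
From mathcomp Require Import all_classical all_reals all_analysis.
From mathcomp Require summability.
From mathcomp Require Import lra.

Set Implicit Arguments.
Unset Strict Implicit.
Unset Printing Implicit Defensive.

Import Order.TTheory GRing.Theory Num.Theory.
Import numFieldNormedType.Exports.

Local Open Scope classical_set_scope.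
Local Open Scope ring_scope.
Local Open Scope complex_scope.

Section Ell2.
Variables (R : realType) (I : choiceType).

Definition cabs (z : R[i]) : R := complex.Re `|z|.

Definition sqnorm (x : I -> R[i]^o) : \bar R :=
  \esum_(i in [set: I]) (cabs (x i) ^+ 2)%:E.

Definition square_summable : {pred I -> R[i]^o} :=
  fun x => (sqnorm x < +oo)%E.

Lemma sqnorm_ge0 x : (0 <= sqnorm x)%E.
Proof. by apply: esum_ge0 => i _; rewrite lee_fin sqr_ge0. Qed.

Lemma sqr_cabs (z : R[i]) :
  cabs z ^+ 2 = complex.Re z ^+ 2 + complex.Im z ^+ 2.
Proof. by rewrite /cabs normc_def /= sqr_sqrtr // addr_ge0 ?sqr_ge0. Qed.

Lemma cabs_ge0 z : 0 <= cabs z.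
Proof. by rewrite /cabs normc_def /= sqrtr_ge0. Qed.

Lemma cabs0 : cabs 0 = 0.
Proof. by rewrite /cabs normr0. Qed.

Lemma cabsM z1 z2 : cabs (z1 * z2) = cabs z1 * cabs z2.
Proof. by rewrite /cabs normrM !normc_def /= mul0r subr0. Qed.

Lemma esumZ_le (c : R) (a : I -> \bar R) : 0 <= c -> (forall i, 0 <= a i)%E ->
  (\esum_(i in [set: I]) (c%:E * a i) <= c%:E * \esum_(i in [set: I]) a i)%E.
Proof.
move=> c0 a0; apply: ge_ereal_sup => _ [A fA <-].
rewrite -ge0_mule_fsumr//; apply: lee_wpmul2l; rewrite ?lee_fin//.
by apply: esum_ge; exists A.
Qed.

Lemma sqnormZ a x : (sqnorm (a *: x)%R <= (cabs a ^+ 2)%:E * sqnorm x)%E.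
Proof.
apply: le_trans (esumZ_le _ _); rewrite ?sqr_ge0//; last first.
  by move=> i; rewrite lee_fin sqr_ge0.
by apply: le_esum => i _; rewrite -EFinM lee_fin -exprMn -cabsM.
Qed.

Lemma sqnormD x y : (sqnorm (x + y)%R <= 2%:E * (sqnorm x + sqnorm y))%E.
Proof.
rewrite -esumD; try by move=> i _; rewrite lee_fin sqr_ge0.
apply: le_trans (esumZ_le _ _) => //; last first.
  by move=> i; rewrite -EFinD lee_fin addr_ge0 ?sqr_ge0.
apply: le_esum => i _; rewrite -EFinD -EFinM lee_fin !sqr_cabs !raddfD /=.
set a := complex.Re _; set b := complex.Re _; set c := complex.Im _.
set d := complex.Im _; have := sqr_ge0 (a - b); have := sqr_ge0 (c - d).
rewrite !expr2; nra.
Qed.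

Lemma square_summable_submod : submod_closed square_summable.
Proof.
split.
  rewrite unfold_in /sqnorm esum1 ?ltry// => i _.
  by rewrite [X in cabs X](_ : _ = 0)// cabs0 expr0n.
move=> a x y xs ys; rewrite unfold_in; apply: le_lt_trans (sqnormD _ _) _.
rewrite lte_mul_pinfty// lte_add_pinfty//.
apply: le_lt_trans (sqnormZ _ _) _.
by rewrite lte_mul_pinfty ?lee_fin ?sqr_ge0.
Qed.

HB.instance Definition _ :=
  GRing.isSubmodClosed.Build R[i] (I -> R[i]^o) square_summable
    square_summable_submod.

Record ell2 := Ell2 {
  ell2_fun :> I -> R[i]^o;
  _ : ell2_fun \in square_summable }.

HB.instance Definition _ := [isSub for ell2_fun].
HB.instance Definition _ := [Choice of ell2 by <:].
HB.instance Definition _ := [SubChoice_isSubLmodule of ell2 by <:].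

Definition ell2_norm (x : ell2) : R := Num.sqrt (fine (sqnorm x)).

(* The sum is the limit over the net of finite subsets of I. *)
Definition inner (x y : ell2) : R[i] :=
  summability.sum (fun i => x i * (y i)^*%C : R[i]^o).

Lemma ell2_normE (x : ell2) : (ell2_norm x ^+ 2)%:E = sqnorm x.
Proof.
have x_fin : (sqnorm x < +oo)%E by exact: (valP x).
rewrite /ell2_norm sqr_sqrtr ?fine_ge0 ?sqnorm_ge0//.
by rewrite fineK// ge0_fin_numE// sqnorm_ge0.
Qed.

Lemma ell2_norm_ge0 x : 0 <= ell2_norm x.
Proof. exact: sqrtr_ge0. Qed.

Lemma ell2_normZ a (x : ell2) : ell2_norm (a *: x) <= cabs a * ell2_norm x.
Proof.
rewrite -(@ler_pXn2r _ 2)// ?nnegrE ?mulr_ge0 ?ell2_norm_ge0 ?cabs_ge0//.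
have : (sqnorm (a *: x : ell2)%R <= (cabs a ^+ 2)%:E * sqnorm x)%E.
  exact: sqnormZ.
by rewrite -!ell2_normE -EFinM lee_fin -exprMn.
Qed.

Lemma ell2_normD (x y : ell2) : ell2_norm (x + y) <= 2 * (ell2_norm x + ell2_norm y).
Proof.
have [x0 y0] := (ell2_norm_ge0 x, ell2_norm_ge0 y).
rewrite -(@ler_pXn2r _ 2)// ?nnegrE ?mulr_ge0 ?addr_ge0 ?ell2_norm_ge0//.
apply: (@le_trans _ _ (2 * (ell2_norm x ^+ 2 + ell2_norm y ^+ 2))).
  have : (sqnorm (x + y : ell2)%R <= 2%:E * (sqnorm x + sqnorm y))%E.
    exact: sqnormD.
  by rewrite -!ell2_normE -EFinD -EFinM lee_fin.
by rewrite !expr2; nra.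
Qed.

Lemma dirac_summable (j : I) :
  (fun i => (i == j)%:R : R[i]^o) \in square_summable.
Proof.
rewrite unfold_in /sqnorm (esumID [set j])//; last first.
  by move=> i _; rewrite lee_fin sqr_ge0.
rewrite [X in (_ + X)%E]esum1 ?adde0; last first.
  by move=> i [_ /eqP/negbTE ->]; rewrite cabs0 expr0n.
by rewrite setTI esum_set1 ?ltry// lee_fin sqr_ge0.
Qed.

Definition xi (j : I) : ell2 := Ell2 (dirac_summable j).

End Ell2.

Section BoundedOperators.
Variables (R : realType) (I : choiceType).
Local Notation H := (ell2 R I).

Definition bounded_operator : {pred H -> H} := fun A =>
  `[< linear A /\ exists M : R, forall x, ell2_norm (A x) <= M * ell2_norm x >].

Lemma bounded_operatorP (A : H -> H) : A \in bounded_operator ->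
  linear A /\
  exists2 M : R, 0 <= M & forall x, ell2_norm (A x) <= M * ell2_norm x.
Proof.
move=> /asboolP[linA [M AM]]; split=> //; exists `|M| => // x.
by apply: le_trans (AM x) _; rewrite ler_wpM2r ?ell2_norm_ge0 ?ler_norm.
Qed.

Lemma bounded_operator_submod : submod_closed bounded_operator.
Proof.
split.
  apply/asboolP; split=> [a x y|]; first by rewrite /= scaler0 addr0.
  exists 0 => x; rewrite mul0r.
  have := ell2_normZ 0 (0 : H); rewrite scale0r cabs0 mul0r.
  exact.
move=> a A B /bounded_operatorP[linA [M M0 AM]].
move=> /bounded_operatorP[linB [N N0 BN]]; apply/asboolP; split.
  move=> b x y; rewrite /= !fctE linA linB !scalerDr !scalerA (mulrC a b).
  by rewrite -!addrA; congr (_ + _); rewrite addrCA.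
exists (2 * (cabs a * M + N)) => x; apply: le_trans (ell2_normD _ _) _.
rewrite -mulrA ler_pM2l// mulrDl lerD//.
apply: le_trans (ell2_normZ _ _) _.
by rewrite -mulrA ler_wpM2l ?cabs_ge0.
Qed.

HB.instance Definition _ :=
  GRing.isSubmodClosed.Build R[i] (H -> H) bounded_operator
    bounded_operator_submod.

Record bop := Bop { bop_fun :> H -> H; _ : bop_fun \in bounded_operator }.

HB.instance Definition _ := [isSub for bop_fun].
HB.instance Definition _ := [Choice of bop by <:].
HB.instance Definition _ := [SubChoice_isSubLmodule of bop by <:].

Lemma bop_linear (A : bop) : linear A.
Proof. by have /bounded_operatorP[] := valP A. Qed.

Lemma bop1_bounded : id \in bounded_operator.
Proof. by apply/asboolP; split=> //; exists 1 => x; rewrite mul1r. Qed.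

Lemma bopM_bounded (A B : bop) : A \o B \in bounded_operator.
Proof.
have /bounded_operatorP[linA [M M0 AM]] := valP A.
have /bounded_operatorP[linB [N N0 BN]] := valP B.
apply/asboolP; split=> [a x y /=|]; first by rewrite linB linA.
exists (M * N) => x /=; apply: le_trans (AM _) _.
by rewrite -mulrA ler_wpM2l.
Qed.

Definition bop1 := Bop bop1_bounded.
Definition bopM A B := Bop (bopM_bounded A B).

Fact bopMA : associative bopM. Proof. by move=> A B C; apply: val_inj. Qed.
Fact bop1M : left_id bop1 bopM. Proof. by move=> A; apply: val_inj. Qed.
Fact bopM1 : right_id bop1 bopM. Proof. by move=> A; apply: val_inj. Qed.
Fact bopMDl : left_distributive bopM +%R.
Proof. by move=> A B C; apply: val_inj. Qed.
Fact bopMDr : right_distributive bopM +%R.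
Proof.
move=> A B C; apply: val_inj; apply/funext => x /=.
by have := bop_linear A 1 (B x) (C x); rewrite !scale1r.
Qed.

HB.instance Definition _ :=
  GRing.Zmodule_isPzRing.Build bop bopMA bop1M bopM1 bopMDl bopMDr.

Definition opnorm (A : bop) : \bar R :=
  ereal_sup [set (ell2_norm (A x))%:E | x in [set x | ell2_norm x <= 1]].

(* The weak operator topology is the coarsest one for which all the
   functionals A |-> <A x, y> are continuous. *)
Definition wot : Type := initial_topology
  (fun (A : bop) => (fun p => inner (A p.1) p.2) : {ptws H * H -> R[i]^o}).

HB.instance Definition _ := Topological.on wot.

Definition wot_closed (S : set bop) := closed (S : set wot).

Definition subalgebra (S : set bop) := [/\ S 0,
  forall (a : R[i]) A B, S A -> S B -> S (a *: A + B) &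
  forall A B, S A -> S B -> S (A * B)].

Definition wot_closed_algebra (gens : set bop) : set bop :=
  smallest [set S | subalgebra S /\ wot_closed S] gens.

End BoundedOperators.

(* A partial injection u of I induces the operator sending xi (u i) to xi i,
   and xi k to 0 when k is not of the form u i. *)
Section Pullback.
Variables (R : realType) (I : choiceType) (u : I -> option I).
Hypothesis u_inj : forall i j k, u i = Some k -> u j = Some k -> i = j.

Definition pullback_fun (x : I -> R[i]^o) : I -> R[i]^o :=
  fun i => oapp x 0 (u i).

Lemma sqnorm_pullback x : (sqnorm (pullback_fun x) <= sqnorm x)%E.
Proof.
rewrite /sqnorm; set f := fun i => (cabs (x i) ^+ 2)%:E.
have f0 i : (0 <= f i)%E by rewrite lee_fin sqr_ge0.
pose P := [set i | isSome (u i)]; pose e i := odflt i (u i).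
rewrite [leLHS](_ : _ = \esum_(i in P) f (e i)); last first.
  rewrite [RHS]esum_mkcond; apply: eq_esum => i _.
  rewrite (_ : (i \in P) = isSome (u i)); last by apply/idP/idP; rewrite inE.
  rewrite /f /e /pullback_fun.
  by case: (u i) => //=; rewrite cabs0 expr0n.
rewrite -(@reindex_esum _ _ _ P (e @` P)).
  rewrite esum_mkcond; apply: le_esum => i _.
  by case: ifP => _; rewrite ?f0// lexx.
apply: inj_bij => i j; rewrite !inE /P /e /=.
case ui: (u i) => [k|]//; case uj : (u j) => [l|]// _ _ /= kl.
by apply: u_inj ui _; rewrite kl.
Qed.

Lemma pullback_summable (x : ell2 R I) : pullback_fun x \in @square_summable R I.
Proof. by apply: le_lt_trans (sqnorm_pullback _) _; exact: (valP x). Qed.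

Definition pullback_ell2 (x : ell2 R I) : ell2 R I := Ell2 (pullback_summable x).

Lemma pullback_bounded : pullback_ell2 \in @bounded_operator R I.
Proof.
apply/asboolP; split=> [a x y|].
  apply: val_inj; apply/funext => i; rewrite /= /pullback_fun.
  by rewrite !fctE; case: (u i) => //=; rewrite scaler0 addr0.
exists 1 => x; rewrite mul1r -(@ler_pXn2r _ 2)// ?nnegrE ?ell2_norm_ge0//.
by rewrite -lee_fin !ell2_normE; exact: sqnorm_pullback.
Qed.

Definition pullback : bop R I := Bop pullback_bounded.

End Pullback.

(* choiceType is no restriction on cardinality: classically every type carries
   such a structure. *)
Record digraph := Digraph {
  vertex : choiceType;
  edge : choiceType;
  src : edge -> vertex;
  rng : edge -> vertex }.

Section Paths.
Variable G : digraph.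

(* An edge sequence e_1 ... e_n with s(e_j) = r(e_{j+1}) and r(e_1) = v. *)
Fixpoint is_path (v : vertex G) (p : seq (edge G)) : bool :=
  if p is e :: q then (rng e == v) && is_path (src e) q else true.

(* A path is encoded as its range together with its edge sequence, so that
   the vertex v is the path (v, [::]). *)
Record gpath := GPath {
  gpath_val :> vertex G * seq (edge G);
  _ : is_path gpath_val.1 gpath_val.2 }.

HB.instance Definition _ := [isSub for gpath_val].
HB.instance Definition _ := [Choice of gpath by <:].

Definition prange (w : gpath) : vertex G := (val w).1.

Lemma econs_subproof e (w : gpath) : src e = prange w ->
  is_path (rng e) (e :: (val w).2).
Proof. by move=> /= ->; rewrite eqxx; exact: (valP w). Qed.

Definition econs e w (ew : src e = prange w) : gpath :=
  @GPath (rng e, e :: (val w).2) (econs_subproof ew).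

(* The path w' such that w = e w', if there is one. *)
Definition euncons (e : edge G) (w : gpath) : option gpath :=
  if (val w).2 is e' :: q then
    if e' == e then insub (src e, q) else None
  else None.

Definition vuncons (x : vertex G) (w : gpath) : option gpath :=
  if prange w == x then Some w else None.

Lemma eunconsP e w w' : euncons e w = Some w' <->
  exists ew' : src e = prange w', w = econs ew'.
Proof.
split=> [|[ew' ->]].
  case: w => -[v [|e' q]]//= qP; rewrite /euncons/=.
  case: eqP => // e'e; subst e'; case: insubP => //= u _ uE [uw'].
  subst u; change (gpath_val w' = (src e, q)) in uE.
  have ew' : src e = prange w' by rewrite /prange /= uE.
  exists ew'; apply: val_inj; rewrite /= uE /=.
  by move: qP => /andP[/eqP->].
rewrite /euncons /= eqxx; case: w' ew' => -[v q] qP /= ew'.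
by rewrite /prange /= in ew'; subst v; rewrite insubT//; congr Some;
  apply: val_inj.
Qed.

Lemma euncons_inj e w1 w2 w :
  euncons e w1 = Some w -> euncons e w2 = Some w -> w1 = w2.
Proof.
move=> /eunconsP[h1 ->] /eunconsP[h2 ->].
by apply: val_inj.
Qed.

Lemma vuncons_inj x w1 w2 w :
  vuncons x w1 = Some w -> vuncons x w2 = Some w -> w1 = w2.
Proof.
by rewrite /vuncons; case: ifP => // _ [->]; case: ifP => // _ [->].
Qed.

End Paths.

Section FreeSemigroupoidAlgebra.
Variables (R : realType) (G : digraph).
Local Notation B := (bop R (gpath G)).
Local Notation xi := (@xi R (gpath G)).

Definition L_edge (e : edge G) : B := pullback R (@euncons_inj G e).
Definition L_vertex (x : vertex G) : B := pullback R (@vuncons_inj G x).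

Lemma L_edge_xi e w (ew : src e = prange w) : L_edge e (xi w) = xi (econs ew).
Proof.
apply: val_inj; apply/funext => w' /=; rewrite /pullback_fun.
case E: (euncons e w') => [w''|] /=.
  move/eunconsP: E => [ew'' ->]; congr (_%:R); congr nat_of_bool.
  apply/eqP/eqP => [ww'|].
    by subst w''; apply: val_inj.
  move=> /(congr1 (fun w => (val w).2)) /= [] eq2; apply: val_inj.
  by rewrite [LHS]surjective_pairing [RHS]surjective_pairing eq2 -[_.1]ew'' ew.
case: eqP => // w'E; exfalso.
by have := (eunconsP e w' w).2 (ex_intro _ ew w'E); rewrite E.
Qed.

Lemma L_edge_xi0 e w : src e != prange w -> L_edge e (xi w) = 0.
Proof.
move=> ew; apply: val_inj; apply/funext => w' /=; rewrite /pullback_fun.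
case E: (euncons e w') => [w''|] //=; case: eqP => // w''w.
by move/eunconsP: E ew => [+ _]; rewrite w''w => ->; rewrite eqxx.
Qed.

Lemma L_vertex_xi x w : L_vertex x (xi w) = if prange w == x then xi w else 0.
Proof.
apply: val_inj; apply/funext => w' /=; rewrite /pullback_fun /vuncons.
case: (eqVneq w' w) => [->|w'w]; first by case: ifP => //= _; rewrite eqxx.
by case: ifP => //= _; case: ifP => //= _; rewrite (negbTE w'w).
Qed.

Definition LG_set : set B :=
  wot_closed_algebra (range L_edge `|` range L_vertex).

Definition LG_pred : {pred B} := fun A => A \in LG_set.

Lemma LG_submod : submod_closed LG_pred.
Proof.
split=> [|a A1 A2].
  by rewrite unfold_in inE => S [[[S0 _ _] _] _].
rewrite !unfold_in !inE => A1G A2G S SG.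
by have [[[_ SD _] _] _] := SG; apply: SD; [exact: A1G|exact: A2G].
Qed.

Lemma LG_mul (A1 A2 : B) :
  A1 \in LG_pred -> A2 \in LG_pred -> A1 * A2 \in LG_pred.
Proof.
rewrite !unfold_in !inE => A1G A2G S SG.
by have [[[_ _ SM] _] _] := SG; apply: SM; [exact: A1G|exact: A2G].
Qed.

HB.instance Definition _ :=
  GRing.isSubmodClosed.Build R[i] B LG_pred LG_submod.

Record LG := MkLG { LG_val :> B; _ : LG_val \in LG_pred }.

HB.instance Definition _ := [isSub for LG_val].
HB.instance Definition _ := [Choice of LG by <:].
HB.instance Definition _ := [SubChoice_isSubLmodule of LG by <:].

Definition LGmul (A1 A2 : LG) : LG := MkLG (LG_mul (valP A1) (valP A2)).

Definition derivation (d : LG -> LG) :=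
  linear d /\
  forall A1 A2, d (LGmul A1 A2) = LGmul (d A1) A2 + LGmul A1 (d A2).

Definition inner_derivation (T A : LG) : LG := LGmul A T - LGmul T A.

(* The operator norm of d, which is +oo when d is unbounded. *)
Definition map_norm (d : LG -> LG) : \bar R :=
  ereal_sup [set opnorm (d A) | A in [set A : LG | (opnorm A <= 1)%E]].

End FreeSemigroupoidAlgebra.

(* Vertices and edges are numbered from 0: edge j goes from vertex j + 1 mod n
   to vertex j. *)
Definition circle_graph (n : nat) : digraph :=
  @Digraph 'I_n 'I_n (@ordS n) id.

Definition digraph_iso (G1 G2 : digraph) : Prop :=
  exists (f : vertex G1 -> vertex G2) (g : edge G1 -> edge G2),
    [/\ bijective f, bijective g,
        forall e, src (g e) = f (src e) & forall e, rng (g e) = f (rng e)].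

Section Components.
Variable G : digraph.

Definition adjacent (x y : vertex G) : Prop := exists e, src e = x /\ rng e = y.

Definition graph_connected : vertex G -> vertex G -> Prop :=
  clos_refl_sym_trans (vertex G) adjacent.

Variable S : set (vertex G).

Definition induced_edges : set (edge G) := [set e | S (src e) /\ S (rng e)].

Definition induced_src (e : induced_edges) : S :=
  SigSub (mem_set (set_mem (valP e)).1).
Definition induced_rng (e : induced_edges) : S :=
  SigSub (mem_set (set_mem (valP e)).2).

Definition induced_subgraph : digraph :=
  @Digraph S induced_edges induced_src induced_rng.

End Components.

Definition graph_component (G : digraph) (x : vertex G) : digraph :=
  induced_subgraph [set y | graph_connected x y].

Definition circle_components (G : digraph) : Prop :=
  forall x : vertex G,
    exists2 n : nat, (1 <= n)%N & digraph_iso (graph_component x) (circle_graph n).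

(* Main.v *)
From Stdlib Require Import Relation_Operators.
Require Import Defs.
From mathcomp Require Import all_boot all_order all_algebra finmap.
From mathcomp Require Import complex.
From mathcomp Require Import all_classical all_reals all_analysis.
From mathcomp Require summability.
From mathcomp Require Import ring lra zify.

Set Implicit Arguments.
Unset Strict Implicit.
Unset Printing Implicit Defensive.

Import Order.TTheory GRing.Theory Num.Theory.
Import numFieldNormedType.Exports.

Local Open Scope classical_set_scope.
Local Open Scope ring_scope.
Local Open Scope complex_scope.

(** The graph is a disjoint union of circles, so every vertex has exactly one
    incoming and one outgoing edge, and a path is determined by its range and
    its length. Write [L] for the algebra, [n] for the length of a circle, and,
    for this circle, [P] for the sum of the vertex projections, [S] for the sum
    of its edges, and [Z = S ^+ n].  All three lie in [L], and [P] and [Z] are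
    central in [L].  The matrix of an element of [L] is determined by its
    coefficients along paths, and only two consequences of this are used.

    - Division ([inLG_quot]): if [A] is in [L] and the degree-zero coefficient of
      [A] at the range of the edge [e] is [a], then [L_e^* (A - a)] is in [L].
      The elements with this property form a weakly closed algebra containing
      the generators.
    - Uniqueness ([is_der_eq0]): a derivation vanishing on vertices and edges is
      zero, since [L_v A = a L_v + L_e A'] reduces a coefficient of [D A] at a
      path to one of [D A'] at a shorter path.

    Let [D] be a derivation.  It kills [P] because [P] is a central idempotent.
    It kills [Z] as well ([der_ccycle]): [D (Z ^+ k) = k Z ^+ (k - 1) (D Z)], and
    for a sufficiently lacunary sum [f] of powers of [Z] with summable
    coefficients, the coefficients of [D f = f' (Z) (D Z)] would be unbounded if
    [D Z] were not zero.  No continuity of [D] is needed, because [D f] agrees in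
    low degree with [D] of a polynomial.

    Let [W] run through the finite family of products of a diagonal matrix of
    signs and a power [S ^+ j] with [j < n], and put [W'] for [Z] times the
    inverse of [W].  Modulo powers of [Z] this family is a group, so
    [X = - average of (D W) W'] satisfies [D A * Z = A X - X A] for all [A] in the
    algebra of the circle: this is the usual proof that derivations of a finite
    group algebra are inner.  The coefficients of [X] of degree less than [n]
    vanish ([cgen_short]), so division gives [T] in [L] with [Z T = X], and [T]
    implements [D] on the circle.  As [S] is isometric, [T] is bounded by the
    largest norm of the [D W].

    For the whole graph, choose for each component the [W] that maximizes the
    norm of [D W].  The direct sum [W] of these contractions is again in [L]
    ([inLG_dsum], by weak convergence of bounded nets, [wot_limit]), and
    compressing [D W] to the components shows that all the local [T] are bounded
    by the norm of [D W].  Hence their direct sum is a bounded operator in [L] of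
    norm at most [map_norm d]; it implements the derivation on the generators,
    and therefore everywhere. *)

(** * Norms of square-summable families *)

Section Ell2Theory.
Variables (R : realType) (I : choiceType).
Local Notation H := (ell2 R I).
Implicit Types (x y : H) (F : {fset I}).

Lemma normc_cabs (z : R[i]) : `|z| = (cabs z)%:C.
Proof. by rewrite /cabs normc_def. Qed.

Lemma cabsD (z1 z2 : R[i]) : cabs (z1 + z2) <= cabs z1 + cabs z2.
Proof. by rewrite -lecR rmorphD /= -!normc_cabs ler_normD. Qed.

Lemma cabsN (z : R[i]) : cabs (- z) = cabs z.
Proof. by rewrite /cabs normrN. Qed.

Lemma cabs_real (r : R) : cabs r%:C = `|r|.
Proof. by rewrite /cabs normc_def /= expr0n addr0 sqrtr_sqr. Qed.

Lemma cabs_eq0 (z : R[i]) : cabs z = 0 -> z = 0.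
Proof. by move=> z0; apply/eqP; rewrite -normr_eq0 normc_cabs z0. Qed.

Definition psq (x : I -> R[i]^o) F : R := \sum_(i <- F) cabs (x i) ^+ 2.

Lemma psq_le_sqnorm (x : I -> R[i]^o) F : ((psq x F)%:E <= sqnorm x)%E.
Proof.
apply: esum_ge; exists [set` F]; first by split => //; exact: finite_fset.
by rewrite fsbig_finite//= set_fsetK -sumEFin.
Qed.

Lemma psq_le x F : psq x F <= ell2_norm x ^+ 2.
Proof. by rewrite -lee_fin ell2_normE psq_le_sqnorm. Qed.

Lemma sqnorm_le (x : I -> R[i]^o) (M : R) :
  (forall F, psq x F <= M) -> (sqnorm x <= M%:E)%E.
Proof.
move=> xM; apply: ge_ereal_sup => _ [A [finA _] <-].
by rewrite fsbig_finite//= sumEFin lee_fin xM.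
Qed.

Lemma ell2_norm_le x (C : R) : 0 <= C ->
  (forall F, psq x F <= C ^+ 2) -> ell2_norm x <= C.
Proof.
move=> C0 xC; rewrite -(@ler_pXn2r _ 2)// ?nnegrE ?ell2_norm_ge0//.
by rewrite -lee_fin ell2_normE sqnorm_le.
Qed.

Lemma psq_approx x (eps : R) : 0 < eps ->
  exists F, ell2_norm x ^+ 2 - eps < psq x F.
Proof.
move=> e0; apply: contrapT => /forallNP noF.
have : (sqnorm x <= (ell2_norm x ^+ 2 - eps)%:E)%E.
  by apply: sqnorm_le => F; rewrite leNgt; apply/negP.
by rewrite -ell2_normE lee_fin; lra.
Qed.

Lemma cabs_le_norm x i : cabs (x i) <= ell2_norm x.
Proof.
rewrite -(@ler_pXn2r _ 2)// ?nnegrE ?ell2_norm_ge0 ?cabs_ge0//.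
by have := psq_le x [fset i]%fset; rewrite /psq big_seq_fset1.
Qed.

Lemma ell2_norm0 : ell2_norm (0 : H) = 0.
Proof.
apply/eqP; rewrite eq_le ell2_norm_ge0 andbT; apply: ell2_norm_le => // F.
by rewrite /psq big1 ?expr0n// => i _; rewrite [X in cabs X](_ : _ = 0)// cabs0 expr0n.
Qed.

Lemma ell2_ext x y : (forall i, x i = y i) -> x = y.
Proof. by move=> xy; apply: val_inj; apply/funext. Qed.

Lemma ell2DE x y i : (x + y) i = x i + y i. Proof. by []. Qed.
Lemma ell2BE x y i : (x - y) i = x i - y i. Proof. by []. Qed.
Lemma ell2ZE (a : R[i]) x i : (a *: x) i = a * x i. Proof. by []. Qed.
Lemma ell2_0E i : (0 : H) i = 0. Proof. by []. Qed.
Lemma ell2_sumE (J : Type) (r : seq J) (f : J -> H) i :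
  (\sum_(j <- r) f j) i = \sum_(j <- r) f j i.
Proof.
elim: r => [|j r IHr]; first by rewrite !big_nil.
by rewrite !big_cons ell2DE IHr.
Qed.

(** The weight [t] makes the arithmetic-geometric inequality sharp after
    optimization, so that it stands in for the Cauchy-Schwarz inequality. *)
Lemma psq_cross (x y : I -> R[i]^o) F (t : R) : 0 < t ->
  \sum_(i <- F) 2 * (cabs (x i) * cabs (y i)) <= t * psq x F + t^-1 * psq y F.
Proof.
move=> t0; rewrite /psq !mulr_sumr -big_split /=; apply: ler_sum => i _.
set a := cabs _; set b := cabs _.
have -> : t * a ^+ 2 + t^-1 * b ^+ 2 = t^-1 * (t * a - b) ^+ 2 + 2 * (a * b).
  by field; rewrite gt_eqF.
by rewrite lerDr mulr_ge0 ?sqr_ge0// invr_ge0 ltW.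
Qed.

Lemma sum_cabsM_le x y F (A B : R) : ell2_norm x < A -> ell2_norm y < B ->
  \sum_(i <- F) cabs (x i) * cabs (y i) <= A * B.
Proof.
move=> xA yB; have := ell2_norm_ge0 x; have := ell2_norm_ge0 y => y0 x0.
have A0 : 0 < A by lra.
have B0 : 0 < B by lra.
have Sx : psq x F <= A ^+ 2.
  by apply: le_trans (psq_le x F) _; rewrite ler_pXn2r ?nnegrE// ltW.
have Sy : psq y F <= B ^+ 2.
  by apply: le_trans (psq_le y F) _; rewrite ler_pXn2r ?nnegrE// ltW.
have BA0 : 0 < B / A by rewrite divr_gt0.
rewrite -(ler_pM2l (@ltr0n R 2)) mulr_sumr.
apply: le_trans (psq_cross x y F BA0) _.
rewrite [leRHS](_ : _ = B / A * A ^+ 2 + (B / A)^-1 * B ^+ 2).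
  by apply: lerD; rewrite ler_wpM2l// ?invr_ge0 ltW.
by field; rewrite !gt_eqF.
Qed.

Lemma ell2_norm_triangle x y : ell2_norm (x + y) <= ell2_norm x + ell2_norm y.
Proof.
set a := ell2_norm x; set b := ell2_norm y.
have a0 : 0 <= a by exact: ell2_norm_ge0.
have b0 : 0 <= b by exact: ell2_norm_ge0.
apply/ler_addgt0Pr => e e0.
pose A := a + e / 2; pose B := b + e / 2.
have aA : a < A by rewrite /A; lra.
have bB : b < B by rewrite /B; lra.
have -> : a + b + e = A + B by rewrite /A /B; field.
apply: ell2_norm_le; first lra.
move=> F; apply: (@le_trans _ _ (psq x F + psq y F
  + 2 * \sum_(i <- F) cabs (x i) * cabs (y i))).
  rewrite /psq mulr_sumr -!big_split; apply: ler_sum => i _.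
  apply: (@le_trans _ _ ((cabs (x i) + cabs (y i)) ^+ 2)).
    by rewrite ler_pXn2r ?nnegrE ?addr_ge0 ?cabs_ge0// ell2DE cabsD.
  by rewrite le_eqVlt; apply/orP; left; apply/eqP => /=; ring.
have -> : (A + B) ^+ 2 = A ^+ 2 + B ^+ 2 + 2 * (A * B) by ring.
have [A0 B0] : 0 <= A /\ 0 <= B by lra.
apply: lerD; last by rewrite ler_pM2l//; exact: sum_cabsM_le.
apply: lerD; [apply: le_trans (psq_le x F) _|apply: le_trans (psq_le y F) _];
  by rewrite ler_pXn2r ?nnegrE// ltW.
Qed.

Lemma ell2_normZE (a : R[i]) x : ell2_norm (a *: x) = cabs a * ell2_norm x.
Proof.
apply/eqP; rewrite eq_le ell2_normZ /=.
have [->|a0] := eqVneq a 0; first by rewrite cabs0 mul0r ell2_norm_ge0.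
have ca : 0 < cabs a.
  rewrite lt0r cabs_ge0 andbT; apply: contraNneq a0 => /cabs_eq0 ->.
  by rewrite eqxx.
have := ell2_normZ a^-1 (a *: x); rewrite scalerA mulVf// scale1r => h.
rewrite -ler_pdivlMl//; apply: le_trans h _.
rewrite ler_wpM2r ?ell2_norm_ge0// -(ler_pM2l ca) mulfV ?gt_eqF//.
by rewrite -cabsM mulfV// /cabs normr1.
Qed.

Lemma ell2_normN x : ell2_norm (- x) = ell2_norm x.
Proof. by rewrite -scaleN1r ell2_normZE cabsN /cabs normr1 mul1r. Qed.

Lemma ell2_norm_sum (J : Type) (r : seq J) (f : J -> H) :
  ell2_norm (\sum_(j <- r) f j) <= \sum_(j <- r) ell2_norm (f j).
Proof.
elim: r => [|j r IHr]; first by rewrite !big_nil ell2_norm0.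
rewrite !big_cons; apply: le_trans (ell2_norm_triangle _ _) _.
by rewrite lerD2l.
Qed.

Lemma ell2_norm_le_pointwise x y :
  (forall i, cabs (x i) <= cabs (y i)) -> ell2_norm x <= ell2_norm y.
Proof.
move=> xy; apply: ell2_norm_le; first exact: ell2_norm_ge0.
move=> F; apply: le_trans (psq_le y F); apply: ler_sum => i _.
by rewrite ler_pXn2r// nnegrE cabs_ge0.
Qed.

(** * Density of the finitely supported vectors *)

Definition trunc x F : H := \sum_(j <- F) x j *: xi R j.

Lemma truncE x F i : trunc x F i = if i \in F then x i else 0.
Proof.
rewrite ell2_sumE; case: ifPn => iF.
  rewrite (big_fsetD1 i)// big1_fset => [|j].
    by rewrite ell2ZE /= eqxx mulr1 addr0.
  by rewrite !inE => /andP[/negbTE ji _] _; rewrite ell2ZE /= eq_sym ji mulr0.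
rewrite big1_fset// => j jF _; rewrite ell2ZE /=.
by case: eqP => [ij|]; rewrite ?mulr0//; move: iF; rewrite ij jF.
Qed.

Lemma trunc_approx x (eps : R) : 0 < eps ->
  exists F, ell2_norm (x - trunc x F) <= eps.
Proof.
move=> e0; have [F Fx] := @psq_approx x (eps ^+ 2) (exprn_gt0 _ e0).
exists F; set y := x - trunc x F.
have yE i : y i = if i \in F then 0 else x i.
  by rewrite ell2BE truncE; case: ifP; rewrite ?subrr ?subr0.
clearbody y; apply: ell2_norm_le; first exact: ltW.
move=> F'; have := psq_le x (F `|` F')%fset.
suff -> : psq x (F `|` F')%fset = psq x F + psq y (F `|` F')%fset.
  suff : psq y F' <= psq y (F `|` F')%fset by lra.
  rewrite /psq [leRHS](big_fsetID _ (mem F'))/=.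
  rewrite [X in _ <= X + _](_ : _ = psq y F').
    by rewrite lerDl; apply: sumr_ge0 => i _; exact: sqr_ge0.
  apply: eq_fbig => // i; rewrite !inE /=.
  by case: (i \in F'); rewrite ?orbT ?andbF.
rewrite /psq [LHS](big_fsetID _ (mem F))/=; congr (_ + _).
  apply: eq_fbig => // i; rewrite !inE /=.
  by case: (i \in F); rewrite ?orbT ?andbF.
rewrite [RHS](big_fsetID _ (mem F))/= [X in X + _]big1_fset ?add0r.
  apply: eq_fbigr => i; rewrite !inE /= => /andP[_ iF] _.
  by rewrite yE (negbTE iF).
move=> i; rewrite !inE /= => /andP[_ iF] _.
by rewrite yE iF cabs0 expr0n.
Qed.

End Ell2Theory.

(** * The inner product *)

Section Inner.
Variables (R : realType) (I : choiceType).
Local Notation H := (ell2 R I).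
Implicit Types (x y z : H) (F : {fset I}).
Import summability.

Local Existing Instance totally_filter.

Definition inner_psum x y F : R[i]^o := \sum_(i <- F) (x i * (y i)^*%C).

Lemma inner_psumE x y :
  partial_sum (fun i => x i * (y i)^*%C : R[i]^o) = inner_psum x y.
Proof. by apply/funext => F; rewrite /partial_sum /inner_psum big_seq_fsetE. Qed.

Lemma psq_cvg x :
  ((psq x F)%:C : R[i]^o) @[F --> totally] --> ((ell2_norm x ^+ 2)%:C : R[i]^o).
Proof.
apply/cvgrPdist_lt => eps; case: eps => e e' /=.
rewrite ltcE/= => /andP[/eqP-> e0].
have [F0 F0x] := psq_approx x e0.
exists F0 => // F /= F0F; rewrite -rmorphB normc_cabs cabs_real ltcR.
have le0 : psq x F0 <= psq x F.
  rewrite /psq [leRHS](big_fsetID _ (mem F0))/=.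
  rewrite [X in _ <= X + _](_ : _ = psq x F0).
    by rewrite lerDl; apply: sumr_ge0 => i _; exact: sqr_ge0.
  apply: eq_fbig => // i; rewrite !inE /=.
  by case: (boolP (i \in F0)) => [/(fsubsetP F0F)->|]; rewrite ?andbF.
rewrite ger0_norm; last by rewrite subr_ge0 psq_le.
lra.
Qed.

(** Polarization reduces convergence of the series defining the inner product to
    monotone convergence of the partial sums of squares. *)
Lemma polarization (a b : R[i]) : a * b^*%C =
  4^-1 * ((cabs (a + b) ^+ 2)%:C - (cabs (a - b) ^+ 2)%:C
   + 'i * (cabs (a + 'i * b) ^+ 2)%:C - 'i * (cabs (a - 'i * b) ^+ 2)%:C).
Proof.
have sqC (z : R[i]) : (cabs z ^+ 2)%:C = z * z^*%C.
  by rewrite rmorphXn /= -normc_cabs sqr_normc.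
rewrite !sqC !rmorphB !rmorphD !rmorphM /=.
have -> : Complex 0 (-1) = - 'i :> R[i] by apply/eqP; rewrite eq_complex /= oppr0 !eqxx.
have i2 : 'i * 'i = -1 :> R[i] by rewrite -expr2 sqr_i.
by field: i2.
Qed.

Lemma cvgMC (T : Type) (Fl : set_system T) {FF : Filter Fl} (a : R[i])
    (f : T -> R[i]^o) (l : R[i]^o) :
  f x @[x --> Fl] --> l -> (a * f x : R[i]^o) @[x --> Fl] --> (a * l : R[i]^o).
Proof. exact: (@cvgZl_tmp _ R[i]^o). Qed.

Lemma cvgDC (T : Type) (Fl : set_system T) {FF : Filter Fl}
    (f g : T -> R[i]^o) (l m : R[i]^o) :
  f x @[x --> Fl] --> l -> g x @[x --> Fl] --> m ->
  (f x + g x : R[i]^o) @[x --> Fl] --> (l + m : R[i]^o).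
Proof. exact: (@cvgD _ R[i]^o). Qed.

Lemma inner_cvg x y :
  inner_psum x y @ totally -->
  (inner x y : R[i]^o).
Proof.
rewrite /inner /sum inner_psumE; apply/cvg_ex.
exists (4^-1 * ((ell2_norm (x + y) ^+ 2)%:C - (ell2_norm (x - y) ^+ 2)%:C
   + 'i * (ell2_norm (x + 'i *: y) ^+ 2)%:C
   - 'i * (ell2_norm (x - 'i *: y) ^+ 2)%:C)).
pose g F : R[i]^o := 4^-1 * ((psq (x + y) F)%:C - (psq (x - y) F)%:C
  + 'i * (psq (x + 'i *: y) F)%:C - 'i * (psq (x - 'i *: y) F)%:C).
apply: (@cvg_trans _ (g @ totally)).
  apply: near_eq_cvg; apply: nearW => F; rewrite /g /inner_psum /psq !rmorph_sum !mulr_sumr.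
  rewrite -sumrB -big_split -sumrB mulr_sumr; apply: eq_bigr => i _.
  exact/esym/polarization.
have h := fun z (a : R[i]) => cvgMC (a := a) (@psq_cvg z).
apply: cvgMC; apply: cvgDC; last first.
  by rewrite -mulNr; under eq_fun do rewrite -mulNr; exact: h.
apply: cvgDC; last exact: h.
apply: cvgDC; first exact: psq_cvg.
by rewrite -mulN1r; under eq_fun do rewrite -mulN1r; exact: h.
Qed.

Lemma inner_eq x y (l : R[i]^o) :
  inner_psum x y @ totally --> l ->
  inner x y = l.
Proof.
rewrite /inner /sum inner_psumE.
exact/(@cvg_lim R[i]^o)/norm_hausdorff.
Qed.

Lemma innerDl x x' y : inner (x + x') y = inner x y + inner x' y.
Proof.
apply: inner_eq.
rewrite (_ : inner_psum _ y = fun F => inner_psum x y F + inner_psum x' y F).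
  by apply: cvgDC; exact: inner_cvg.
apply/funext => F; rewrite /inner_psum -[RHS]big_split; apply: eq_bigr => i _.
exact: mulrDl.
Qed.

Lemma innerZl a x y : inner (a *: x) y = a * inner x y.
Proof.
apply: inner_eq; rewrite (_ : inner_psum _ y = fun F => a * inner_psum x y F).
  by apply: cvgMC; exact: inner_cvg.
apply/funext => F; rewrite /inner_psum [RHS]mulr_sumr; apply: eq_bigr => i _.
exact/esym/mulrA.
Qed.

Lemma innerDr x y y' : inner x (y + y') = inner x y + inner x y'.
Proof.
apply: inner_eq.
rewrite (_ : inner_psum x _ = fun F => inner_psum x y F + inner_psum x y' F).
  by apply: cvgDC; exact: inner_cvg.
apply/funext => F; rewrite /inner_psum -[RHS]big_split; apply: eq_bigr => i _.
by rewrite ell2DE rmorphD; exact: mulrDr.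
Qed.

Lemma innerZr a x y : inner x (a *: y) = a^*%C * inner x y.
Proof.
apply: inner_eq; rewrite (_ : inner_psum x _ = fun F => a^*%C * inner_psum x y F).
  by apply: cvgMC; exact: inner_cvg.
apply/funext => F; rewrite /inner_psum [RHS]mulr_sumr; apply: eq_bigr => i _.
by rewrite ell2ZE rmorphM; exact: mulrCA.
Qed.

Lemma innerBl x x' y : inner (x - x') y = inner x y - inner x' y.
Proof. by rewrite innerDl -scaleN1r innerZl mulN1r. Qed.

Lemma inner0r x : inner x 0 = 0.
Proof. by rewrite -(scale0r 0) innerZr rmorph0 mul0r. Qed.

Lemma inner_sumr (J : Type) (r : seq J) (f : J -> H) x :
  inner x (\sum_(j <- r) f j) = \sum_(j <- r) inner x (f j).
Proof.
elim: r => [|j r IHr]; last by rewrite !big_cons innerDr IHr.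
by rewrite !big_nil inner0r.
Qed.

Lemma inner_xi x j : inner x (xi R j) = x j.
Proof.
apply: inner_eq; apply: cvg_near_cst; exists [fset j]%fset => // F /= jF.
rewrite /inner_psum (big_fsetD1 j) ?(fsubsetP jF) ?inE//= eqxx rmorph1 mulr1.
rewrite big1_fset ?addr0// => i; rewrite !inE => /andP[/negbTE ij _] _.
by rewrite /= ij rmorph0 mulr0.
Qed.

(** The strict bounds [A] and [B] keep the optimal weight [B / A] of [psq_cross]
    well defined when a vector vanishes. *)
Lemma inner_bound x y (A B : R) : ell2_norm x < A -> ell2_norm y < B ->
  cabs (inner x y) <= A * B.
Proof.
move=> xA yB; apply/ler_addgt0Pr => e e0.
have e0' : 0 < e%:C :> R[i] by rewrite ltcR.
have /cvgrPdist_lt/(_ _ e0')[F _ /(_ F (fsubset_refl _))/=] := @inner_cvg x y.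
rewrite normc_cabs ltcR => /ltW h.
rewrite -[inner x y](subrK (\sum_(i <- F) (x i * (y i)^*%C))).
apply: le_trans (cabsD _ _) _; rewrite addrC; apply: lerD => //.
apply: le_trans (sum_cabsM_le F xA yB).
elim/big_ind2 : _ => [|a b c d ab cd|i _]; first by rewrite cabs0.
  by apply: le_trans (cabsD _ _) _; exact: lerD.
by rewrite cabsM le_eqVlt; apply/orP; left; rewrite /cabs normcJ.
Qed.

(** Both sides are bounded and additive in [y], so that it suffices to compare
    them on basis vectors. *)
Lemma inner_adjoint (C C' : bop R I) :
  (forall x j, (C x) j = inner x (C' (xi R j))) ->
  forall x y, inner (C x) y = inner x (C' y).
Proof.
move=> CC' x y; apply/eqP; rewrite -subr_eq0; apply/eqP/cabs_eq0/eqP.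
rewrite eq_le cabs_ge0 andbT; apply/ler_addgt0Pr => e e0; rewrite add0r.
have [_ [M M0 MC']] := bounded_operatorP (valP C').
pose a := ell2_norm (C x) + 1; pose b := ell2_norm x + 1.
have a1 : 0 < a by have := ell2_norm_ge0 (C x); rewrite /a; lra.
have b1 : 0 < b by have := ell2_norm_ge0 x; rewrite /b; lra.
pose K := a + b * (M + 1).
have K0 : 0 < K by rewrite /K; nra.
have eK0 : 0 < e / (2 * K) by rewrite divr_gt0// mulr_gt0.
have [F yF] := @trunc_approx R I y _ eK0.
have {yF} [u yF ->] : exists2 u, ell2_norm u <= e / (2 * K) & y = trunc y F + u.
  by exists (y - trunc y F); rewrite // addrC subrK.
have C'D z z' : C' (z + z') = C' z + C' z'.
  by have := bop_linear C' 1 z z'; rewrite !scale1r.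
have C'0 : C' 0 = 0.
  by have /eqP := C'D 0 0; rewrite addr0 addrC -subr_eq subrr => /eqP.
have C'Z c z : C' (c *: z) = c *: C' z.
  by have := bop_linear C' c z 0; rewrite C'0 !addr0.
rewrite C'D !innerDr.
have -> : inner (C x) (trunc y F) = inner x (C' (trunc y F)).
  rewrite /trunc (big_morph _ C'D C'0) !inner_sumr; apply: eq_bigr => j _.
  by rewrite C'Z !innerZr inner_xi CC'.
rewrite opprD addrACA subrr add0r.
apply: le_trans (cabsD _ _) _; rewrite cabsN.
have ue : ell2_norm u < e / K.
  by apply: le_lt_trans yF _; rewrite ltr_pM2l// ltf_pV2 ?posrE ?mulr_gt0//; lra.
have C'ue : ell2_norm (C' u) < (M + 1) * (e / K).
  apply: le_lt_trans (MC' u) _.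
  have := ell2_norm_ge0 u; nra.
apply: (@le_trans _ _ (a * (e / K) + b * ((M + 1) * (e / K)))).
  by apply: lerD; apply: inner_bound => //; rewrite /a /b; lra.
by rewrite le_eqVlt; apply/orP; left; apply/eqP; rewrite /K; field; rewrite gt_eqF.
Qed.

End Inner.

(** * The weak operator topology *)

Lemma cvg_to_initial (S : choiceType) (T : topologicalType) (f : S -> T)
    (Fl : set_system S) {FF : Filter Fl} (s : S) :
  f @ Fl --> f s -> Fl --> (s : initial_topology f).
Proof.
move=> h U; have -> := @nbhsE (initial_topology f) s.
move=> -[_ [[W Wop <-] Ws] sub].
by apply: filterS sub _; apply: h; exact: open_nbhs_nbhs.
Qed.

Section WeakOperatorTopology.
Variables (R : realType) (I : choiceType).
Local Notation H := (ell2 R I).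
Local Notation B := (bop R I).
Implicit Types (x y : H).

Lemma wot_cvg (Fl : set_system B) {FF : Filter Fl} (A : B) :
  (forall x y, (inner (C x) y : R[i]^o) @[C --> Fl] --> (inner (A x) y : R[i]^o)) ->
  Fl --> (A : wot R I).
Proof.
move=> h; set Phi := fun (A : bop R I) =>
  (fun p => inner (A p.1) p.2) : {ptws H * H -> R[i]^o}.
apply: (@cvg_to_initial _ _ Phi); apply/cvg_sup => p.
apply: (@cvg_to_initial _ _ (fun f : {ptws H * H -> R[i]^o} => f p)).
exact: (h p.1 p.2).
Qed.

Lemma wot_continuous_inner x y :
  continuous ((fun A : B => inner (A x) y) : wot R I -> R[i]^o).
Proof.
set Phi := fun (A : bop R I) =>
  (fun p => inner (A p.1) p.2) : {ptws H * H -> R[i]^o}.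
have Phi_cont : continuous (Phi : wot R I -> _) by exact: initial_continuous.
move=> A; have h := @proj_continuous (H * H)%type (fun=> R[i]^o) (x, y) (Phi A).
exact: (cvg_comp _ _ (Phi_cont A) h).
Qed.

Lemma wot_continuous_coord x i :
  continuous ((fun A : B => (A x) i) : wot R I -> R[i]^o).
Proof.
rewrite (_ : (fun A => _) = fun A : B => inner (A x) (xi R i)).
  exact: wot_continuous_inner.
by apply/funext => A; rewrite inner_xi.
Qed.

(** Left multiplication is weakly continuous as soon as the factor has an
    adjoint; the scalar term is what [quot] below needs. *)
Lemma wot_continuous_sub_scale (C C' : B) (phi : B -> R[i]^o) :
  (forall x j, (C x) j = inner x (C' (xi R j))) ->
  continuous (phi : wot R I -> R[i]^o) ->
  continuous ((fun A : B => C * A - phi A *: C) : wot R I -> wot R I).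
Proof.
move=> CC' phi_cont A.
have FF : Filter (nbhs (A : wot R I)) by exact: nbhs_filter.
apply: (wot_cvg (FF := fmap_filter _ FF)) => x y.
pose g (D : B) : R[i]^o := inner (D x) (C' y) + - inner (C x) y * phi D.
have gE (D : B) : inner ((C * D - phi D *: C) x) y = g D.
  rewrite /g -(inner_adjoint CC') mulNr mulrC -innerZl -innerBl.
  by congr inner.
have : g D @[D --> (A : wot R I)] --> g A.
  apply: cvgDC; first exact: wot_continuous_inner.
  by apply: cvgMC; exact: phi_cont.
by rewrite gE (funext (fun D => esym (gE D))).
Qed.

Lemma wot_closed_eq (phi psi : B -> R[i]^o) :
  continuous (phi : wot R I -> R[i]^o) -> continuous (psi : wot R I -> R[i]^o) ->
  wot_closed [set A | phi A = psi A].
Proof.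
move=> cphi cpsi A clA; apply/eqP; rewrite -subr_eq0 -normr_eq0 eq_le normr_ge0 andbT.
apply/ler_addgt0Pr => e e0; rewrite add0r.
have e20 : 0 < e / 2 by rewrite divr_gt0.
have /cvgrPdist_lt/(_ _ e20) h1 := cphi A.
have /cvgrPdist_lt/(_ _ e20) h2 := cpsi A.
have [D [/= De [D1 D2]]] := clA _ (filterI h1 h2).
rewrite [e]splitr -(subrKA (phi D)) {2}De.
apply: le_trans (ler_normD _ _) _; apply: lerD; first exact: ltW.
by rewrite distrC ltW.
Qed.

Lemma wot_closed_forall (J : Type) (S : J -> set B) :
  (forall j, wot_closed (S j)) -> wot_closed [set A | forall j, S j A].
Proof.
move=> clS A clA j; apply: clS => U /clA[D [SD UD]]; exists D; split => //.
Qed.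

End WeakOperatorTopology.

(** * Weak limits of bounded nets *)

Section CoordinatewiseLimits.
Variables (R : realType) (I : choiceType).
Local Notation H := (ell2 R I).
Local Notation B := (bop R I).
Implicit Types (x y : H).

Lemma bopE_D (A C : B) x : (A + C) x = A x + C x. Proof. by []. Qed.
Lemma bopE_B (A C : B) x : (A - C) x = A x - C x. Proof. by []. Qed.
Lemma bopE_Z (a : R[i]) (A : B) x : (a *: A) x = a *: A x. Proof. by []. Qed.
Lemma bopE_M (A C : B) x : (A * C) x = A (C x). Proof. by []. Qed.
Lemma bopE_0 x : (0 : B) x = 0. Proof. by []. Qed.
Lemma bopE_sum (J : Type) (r : seq J) (f : J -> B) x :
  (\sum_(j <- r) f j) x = \sum_(j <- r) f j x.
Proof.
elim: r => [|j r IHr]; first by rewrite !big_nil.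
by rewrite !big_cons bopE_D IHr.
Qed.

Lemma bop_ext (A C : B) : (forall x i, (A x) i = (C x) i) -> A = C.
Proof. by move=> eqAC; apply: val_inj; apply/funext => x; exact: ell2_ext (eqAC x). Qed.

Lemma bop_scaleAl (a : R[i]) (A C : B) : a *: (A * C) = (a *: A) * C.
Proof. exact: val_inj. Qed.

Lemma bop_applyD (A : B) x y : A (x + y) = A x + A y.
Proof. by have := bop_linear A 1 x y; rewrite !scale1r. Qed.

Lemma bop_apply0 (A : B) : A 0 = 0.
Proof. by have /eqP := bop_applyD A 0 0; rewrite addr0 addrC -subr_eq subrr => /eqP. Qed.

Lemma bop_applyZ (A : B) a x : A (a *: x) = a *: A x.
Proof. by have := bop_linear A a x 0; rewrite !addr0 bop_apply0 addr0. Qed.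

Lemma bop_scaleAr (a : R[i]) (A C : B) : a *: (A * C) = A * (a *: C).
Proof. by apply: val_inj; apply/funext => x; rewrite -[RHS]/(A (a *: C x)) bop_applyZ. Qed.

Lemma near_fset (J : Type) (Fl : set_system J) {FF : Filter Fl} (F : {fset I})
    (P : I -> J -> Prop) :
  (forall i, \forall j \near Fl, P i j) ->
  \forall j \near Fl, forall i, i \in F -> P i j.
Proof.
move=> PF; have := @filter_bigI _ I F (fun i => [set j | P i j]) Fl FF.
move=> /(_ (fun i _ => PF i)); apply: filterS => j /= h i iF.
exact: h.
Qed.

(** A bounded net of operators whose matrix entries are eventually constant
    converges weakly: on finitely supported vectors nothing moves any more, and
    the uniform bound transports this to their closure. *)
Lemma wot_limit (J : Type) (Fl : set_system J) {FF : ProperFilter Fl}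
    (C : J -> B) (K : R) (g : H -> I -> R[i]) :
  0 <= K -> (forall j x, ell2_norm (C j x) <= K * ell2_norm x) ->
  (forall x i, \forall j \near Fl, (C j x) i = g x i) ->
  exists D : B, [/\ forall x i, (D x) i = g x i,
    forall x, ell2_norm (D x) <= K * ell2_norm x &
    C j @[j --> Fl] --> (D : wot R I)].
Proof.
move=> K0 CK Cg.
have nearF x (F : {fset I}) : \forall j \near Fl, forall i, i \in F -> (C j x) i = g x i.
  exact: (near_fset (P := fun i j => (C j x) i = g x i) F (Cg x)).
have gle x F : psq (g x) F <= (K * ell2_norm x) ^+ 2.
  have /filter_ex[j jF] := nearF x F.
  rewrite (_ : psq _ F = psq (C j x) F); last first.
    by apply: eq_fbigr => i iF _; rewrite jF.
  apply: le_trans (psq_le _ _) _.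
  by rewrite ler_pXn2r ?nnegrE ?mulr_ge0 ?ell2_norm_ge0.
have gsum x : g x \in @square_summable R I.
  by apply: le_lt_trans (sqnorm_le (gle x)) _; rewrite ltry.
pose D0 x : H := Ell2 (gsum x).
have D0K x : ell2_norm (D0 x) <= K * ell2_norm x.
  by apply: ell2_norm_le; [rewrite mulr_ge0 ?ell2_norm_ge0|exact: gle].
have D0b : D0 \in @bounded_operator R I.
  apply/asboolP; split; last by exists K.
  move=> a x y; apply: ell2_ext => i /=.
  have h : \forall j \near Fl, ((C j x) i = g x i /\ (C j y) i = g y i) /\
      (C j (a *: x + y)) i = g (a *: x + y) i.
    by apply: filterI; [apply: filterI|]; exact: Cg.
  have [j [[/= jx jy] jxy]] := filter_ex h.
  by rewrite !fctE -jx -jy -jxy bop_linear.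
exists (Bop D0b); split => //; apply: wot_cvg => x y.
pose A := 2 * (K * ell2_norm x) + 1.
have A1 : 0 < A by rewrite ltr_wpDl// !mulr_ge0 ?ell2_norm_ge0.
apply/cvgrPdist_lt => eps; case: eps => e e' /=.
rewrite ltcE/= => /andP[/eqP-> e0].
(* [A] bounds [D x - C j x]; the factor 4 leaves room for strict inequalities. *)
have eA0 : 0 < e / (4 * A) by rewrite divr_gt0// mulr_gt0.
have [F yF] := trunc_approx y eA0.
have := nearF x F; apply: filterS => j jF.
rewrite /= -innerBl normc_cabs ltcR.
have {yF} [u yF ->] : exists2 u, ell2_norm u <= e / (4 * A) & y = trunc y F + u.
  by exists (y - trunc y F); rewrite // addrC subrK.
rewrite innerDr [X in X + _](_ : _ = 0) ?add0r; last first.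
  rewrite /trunc inner_sumr big1_fset// => i iF _.
  by rewrite innerZr inner_xi ell2BE jF//= subrr mulr0.
apply: (@le_lt_trans _ _ (A * (e / (2 * A)))); last first.
  by rewrite [ltLHS](_ : _ = e / 2); [lra|field; rewrite gt_eqF].
apply: inner_bound.
  apply: le_lt_trans (ell2_norm_triangle _ _) _; rewrite ell2_normN /A.
  by have := CK j x; have := D0K x; rewrite /=; lra.
apply: le_lt_trans yF _; rewrite ltr_pM2l// ltf_pV2 ?posrE ?mulr_gt0//; lra.
Qed.

End CoordinatewiseLimits.

(** * The free semigroupoid algebra *)

Section AlgebraBasics.
Variables (R : realType) (G : digraph).
Local Notation H := (ell2 R (gpath G)).
Local Notation B := (bop R (gpath G)).
Implicit Types (x y : H) (A C : B).

Definition inLG A : Prop := @LG_set R G A.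

Lemma inLG_closed : wot_closed (inLG : set B).
Proof.
move=> A clA S SG; have [[_ clS] _] := SG; apply: clS => U /clA[D [DG UD]].
by exists D; split => //; exact: DG.
Qed.

Lemma inLG_edge e : inLG (L_edge R e).
Proof. by move=> S [_ sub]; apply: sub; left; exists e. Qed.

Lemma inLG_vertex v : inLG (L_vertex R v).
Proof. by move=> S [_ sub]; apply: sub; right; exists v. Qed.

Lemma inLG0 : inLG (0 : B).
Proof. by move=> S [[[S0 _ _] _] _]. Qed.

Lemma inLG_lin (a : R[i]) A C : inLG A -> inLG C -> inLG (a *: A + C).
Proof.
by move=> hA hC S SG; have [[[_ SD _] _] _] := SG; apply: SD; [exact: hA|exact: hC].
Qed.

Lemma inLGM A C : inLG A -> inLG C -> inLG (A * C).
Proof.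
by move=> hA hC S SG; have [[[_ _ SM] _] _] := SG; apply: SM; [exact: hA|exact: hC].
Qed.

Lemma inLGD A C : inLG A -> inLG C -> inLG (A + C).
Proof. by move=> hA hC; rewrite -[A]scale1r; exact: inLG_lin. Qed.

Lemma inLGZ a A : inLG A -> inLG (a *: A).
Proof. by move=> hA; rewrite -[a *: A]addr0; apply: inLG_lin => //; exact: inLG0. Qed.

Lemma inLGN A : inLG A -> inLG (- A).
Proof. by rewrite -scaleN1r; exact: inLGZ. Qed.

Lemma inLGB A C : inLG A -> inLG C -> inLG (A - C).
Proof. by move=> hA /inLGN; exact: inLGD. Qed.

Lemma inLG_sum (J : Type) (r : seq J) (f : J -> B) :
  (forall j, inLG (f j)) -> inLG (\sum_(j <- r) f j).
Proof.
move=> fG; elim: r => [|j r IHr]; first by rewrite big_nil; exact: inLG0.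
by rewrite big_cons; exact: inLGD.
Qed.

(** The inductive steps may use membership in the algebra, because [S] can be
    replaced by its intersection with the algebra. *)
Lemma inLG_ind (S : set B) :
  (forall e, S (L_edge R e)) -> (forall v, S (L_vertex R v)) ->
  S 0 ->
  (forall a A C, inLG A -> inLG C -> S A -> S C -> S (a *: A + C)) ->
  (forall A C, inLG A -> inLG C -> S A -> S C -> S (A * C)) ->
  wot_closed S ->
  forall A, inLG A -> S A.
Proof.
move=> SE SV S0 Slin SM clS A AG.
suff : (S `&` inLG) A by case.
apply: AG; split; last first.
  move=> _ [[e _ <-]|[v _ <-]]; split => //; [exact: inLG_edge|exact: inLG_vertex].
split; last by apply: closedI => //; exact: inLG_closed.
split; first by split => //; exact: inLG0.
  by move=> a A1 A2 [SA1 G1] [SA2 G2]; split; [exact: Slin|exact: inLG_lin].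
by move=> A1 A2 [SA1 G1] [SA2 G2]; split; [exact: SM|exact: inLGM].
Qed.

Lemma inLG_limit (J : Type) (Fl : set_system J) {FF : ProperFilter Fl}
    (C : J -> B) (K : R) (g : H -> gpath G -> R[i]) :
  0 <= K -> (forall j, inLG (C j)) ->
  (forall j x, ell2_norm (C j x) <= K * ell2_norm x) ->
  (forall x w, \forall j \near Fl, (C j x) w = g x w) ->
  exists D : B, [/\ inLG D, forall x w, (D x) w = g x w &
    forall x, ell2_norm (D x) <= K * ell2_norm x].
Proof.
move=> K0 CG CK Cg; have [D [Dg DK CD]] := wot_limit K0 CK Cg.
exists D; split => //; apply: (closed_cvg _ inLG_closed _ _ CD).
by apply: nearW => j; exact: CG.
Qed.

End AlgebraBasics.

(** * Coordinates along paths *)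

Section PathCoordinates.
Variables (R : realType) (G : digraph).
Local Notation H := (ell2 R (gpath G)).
Local Notation B := (bop R (gpath G)).
Implicit Types (x y : H) (A C : B) (w : gpath G) (e f : edge G) (v : vertex G).

Definition vpath v : gpath G := @GPath G (v, [::]) isT.

Definition plen w : nat := size (val w).2.

Lemma prange_vpath v : prange (vpath v) = v. Proof. by []. Qed.

Lemma prange_econs e w (ew : src e = prange w) : prange (econs ew) = rng e.
Proof. by []. Qed.

Lemma gpath_ind (P : gpath G -> Prop) :
  (forall v, P (vpath v)) ->
  (forall e w (ew : src e = prange w), P w -> P (econs ew)) ->
  forall w, P w.
Proof.
move=> Pv Pe [[v p] pP]; elim: p v pP => [|e p IHp] v pP.
  by rewrite (_ : GPath pP = vpath v)//; exact: val_inj.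
have /= /andP[/eqP ev pP'] := pP; subst v.
have ew : src e = prange (@GPath G (src e, p) pP') by [].
by rewrite (_ : GPath pP = econs ew); [exact/Pe/IHp|exact: val_inj].
Qed.

Lemma econs_inj e f w w' (ew : src e = prange w) (fw : src f = prange w') :
  econs ew = econs fw -> e = f /\ w = w'.
Proof.
move=> /(congr1 (fun w => (val w).2)) /= [ef ww']; split => //.
by apply: val_inj; rewrite [LHS]surjective_pairing [RHS]surjective_pairing ww'
  -[_.1]ew -[_.1 in RHS]fw ef.
Qed.

Lemma L_edge_vpath e x v : (L_edge R e x) (vpath v) = 0.
Proof. by []. Qed.

Lemma L_edge_econs e x w f (fw : src f = prange w) :
  (L_edge R e x) (econs fw) = if f == e then x w else 0.
Proof.
rewrite /= /pullback_fun; case: eqP => [fe|fe].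
  subst f; have := (eunconsP e (econs fw) w).2 (ex_intro _ fw erefl).
  by move=> ->.
case E : euncons => [w'|]//=; have [ew' /econs_inj[]] := (eunconsP _ _ _).1 E.
by move=> fe'; case: fe.
Qed.

Lemma L_vertexE v x w : (L_vertex R v x) w = if prange w == v then x w else 0.
Proof. by rewrite /= /pullback_fun /vuncons; case: ifP. Qed.

(** The path [e w], if it exists; pulling back along it is the adjoint of
    [L_edge e]. *)
Definition epush e w : option (gpath G) :=
  if src e == prange w then insub (rng e, e :: (val w).2) else None.

Lemma epushE e w (ew : src e = prange w) : epush e w = Some (econs ew).
Proof.
rewrite /epush ew eqxx insubT => [|h].
  by rewrite /= eqxx ew; exact: (valP w).
by congr Some; apply: val_inj.
Qed.

Lemma epushP e w w' : epush e w = Some w' -> exists ew : src e = prange w, w' = econs ew.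
Proof.
case: (eqVneq (src e) (prange w)) => [ew|ew].
  by rewrite (epushE ew) => -[<-]; exists ew.
by rewrite /epush (negbTE ew).
Qed.

Lemma epush_inj e w1 w2 w : epush e w1 = Some w -> epush e w2 = Some w -> w1 = w2.
Proof. by move=> /epushP[h1 ->] /epushP[h2 /econs_inj[]]. Qed.

Definition L_edge_adj e : B := pullback R (@epush_inj e).

Lemma L_edge_adjE e x w (ew : src e = prange w) : (L_edge_adj e x) w = x (econs ew).
Proof. by rewrite /= /pullback_fun (epushE ew). Qed.

Lemma L_edge_adj0 e x w : src e != prange w -> (L_edge_adj e x) w = 0.
Proof. by move=> ew; rewrite /= /pullback_fun /epush (negbTE ew). Qed.

Lemma L_edge_adj_inner e x w : (L_edge_adj e x) w = inner x (L_edge R e (xi R w)).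
Proof.
case: (eqVneq (src e) (prange w)) => [ew|ew].
  by rewrite L_edge_adjE L_edge_xi inner_xi.
by rewrite L_edge_adj0// L_edge_xi0// inner0r.
Qed.

End PathCoordinates.

(** * Left division by an edge *)

Section Division.
Variables (R : realType) (G : digraph).
Local Notation H := (ell2 R (gpath G)).
Local Notation B := (bop R (gpath G)).
Local Notation inLG := (@inLG R G).
Implicit Types (x y : H) (A C : B) (w : gpath G) (e f : edge G) (v : vertex G).

(** The degree-zero coefficient at [v]; it is a weakly continuous character of the
    algebra. *)
Definition chi v A : R[i] := (A (xi R (vpath v))) (vpath v).

Lemma chi_lin v a A C : chi v (a *: A + C) = a * chi v A + chi v C.
Proof. by []. Qed.

(** The value at the trivial path only involves the value of the argument there,
    because multiplication by a generator never shortens a path. *)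
Lemma inLG_chi A v y : inLG A -> (A y) (vpath v) = chi v A * y (vpath v).
Proof.
rewrite mulrC -ell2ZE -bop_applyZ => AG; move: A AG y.
pose S A := forall y, (A y) (vpath v) = (A (y (vpath v) *: xi R (vpath v))) (vpath v).
change (forall A, inLG A -> S A); apply: inLG_ind; rewrite /S.
- by move=> e y; rewrite !L_edge_vpath.
- by move=> u y; rewrite !L_vertexE ell2ZE /= eqxx mulr1.
- by [].
- by move=> a A C _ _ hA hC y; rewrite !bopE_D !bopE_Z !ell2DE !ell2ZE hA hC.
- by move=> A C _ _ hA hC y; rewrite !bopE_M hA [in RHS]hA hC.
apply: wot_closed_forall => y; apply: wot_closed_eq; exact: wot_continuous_coord.
Qed.

Lemma chiM v A C : inLG A -> chi v (A * C) = chi v A * chi v C.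
Proof. by move=> AG; rewrite /chi bopE_M inLG_chi. Qed.

Lemma chi_edge v e : chi v (L_edge R e) = 0.
Proof. exact: L_edge_vpath. Qed.

Lemma chi_vertex v u : chi v (L_vertex R u) = (v == u)%:R.
Proof. by rewrite /chi L_vertexE /= eqxx; case: ifP. Qed.

Lemma chi_cont v : continuous (chi v : wot R (gpath G) -> R[i]^o).
Proof. exact: wot_continuous_coord. Qed.

Definition quot e A : B := L_edge_adj R e * A - chi (rng e) A *: L_edge_adj R e.

(** Division by [L_edge e]: after removal of the degree-zero part, every element
    of the algebra can be divided on the left without leaving the algebra. *)
Lemma inLG_quot e A : inLG A -> inLG (quot e A).
Proof.
move: A; apply: (inLG_ind (S := [set A | inLG (quot e A)])) => /=.
- move=> f; rewrite (_ : quot e _ = if f == e then L_vertex R (src e) else 0).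
    by case: ifP => _; [exact: inLG_vertex|exact: inLG0].
  apply: bop_ext => y w; rewrite /quot chi_edge scale0r subr0 bopE_M.
  case: (eqVneq (src e) (prange w)) => [ew|ew].
    rewrite L_edge_adjE L_edge_econs eq_sym; case: ifP => // _.
    by rewrite L_vertexE ew eqxx.
  rewrite L_edge_adj0//; case: ifP => // _.
  by rewrite L_vertexE eq_sym (negbTE ew).
- move=> v; rewrite (_ : quot e _ = 0); first exact: inLG0.
  apply: bop_ext => y w; rewrite /quot chi_vertex bopE_B bopE_M bopE_Z ell2BE ell2ZE.
  case: (eqVneq (src e) (prange w)) => [ew|ew].
    rewrite !L_edge_adjE L_vertexE prange_econs.
    by case: ifP; rewrite ?mul1r ?mul0r subrr.
  by rewrite !L_edge_adj0// mulr0 subrr.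
- by rewrite /quot mulr0 /chi bopE_0 ell2_0E scale0r subr0; exact: inLG0.
- move=> a A C AG CG hA hC; rewrite (_ : quot e _ = a *: quot e A + quot e C).
    exact: inLG_lin.
  rewrite /quot chi_lin mulrDr -bop_scaleAr scalerDl scalerBr scalerA opprD.
  by rewrite addrACA.
- move=> A C AG CG hA hC.
  rewrite (_ : quot e _ = quot e A * C + chi (rng e) A *: quot e C).
    by apply: inLGD; [exact: inLGM|exact: inLGZ].
  rewrite /quot chiM// mulrBl scalerBr scalerA mulrA.
  by rewrite bop_scaleAl addrA subrK.
have cont : continuous (quot e : wot R (gpath G) -> wot R (gpath G)).
  apply: wot_continuous_sub_scale (@chi_cont (rng e)) => x w.
  exact: L_edge_adj_inner.
by apply: (preimage_closed (in1W cont)); exact: inLG_closed.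
Qed.

Definition is_der (D : B -> B) : Prop :=
  [/\ forall A, inLG A -> inLG (D A),
      forall (a : R[i]) A C, inLG A -> inLG C -> D (a *: A + C) = a *: D A + D C &
      forall A C, inLG A -> inLG C -> D (A * C) = D A * C + A * D C].

Lemma L_vertex_quot v e A : injective (@rng G) -> rng e = v -> inLG A ->
  L_vertex R v * A = chi v A *: L_vertex R v + L_edge R e * quot e A.
Proof.
move=> rng_inj ev AG; subst v; apply: bop_ext => y w.
rewrite bopE_D bopE_Z !bopE_M ell2DE ell2ZE !L_vertexE.
elim/gpath_ind: w => [v|f w fw _].
  rewrite L_edge_vpath addr0 prange_vpath; case: eqP => [->|]; rewrite ?mulr0//.
  exact: inLG_chi.
rewrite L_edge_econs !prange_econs (inj_eq rng_inj).
case: eqP => [fe|]; last by rewrite mulr0 addr0.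
by subst f; rewrite /quot bopE_B bopE_M bopE_Z ell2BE ell2ZE !L_edge_adjE addrC subrK.
Qed.

(** When each vertex receives exactly one edge, the identity
    [L_v A = chi v A *: L_v + L_e A'] expresses [D A] at a path through [D A'] at
    a shorter path, so that a derivation is determined by the generators. *)
Lemma is_der_eq0 (D : B -> B) :
  injective (@rng G) -> (forall v, exists e, rng e = v) ->
  is_der D -> (forall e, D (L_edge R e) = 0) -> (forall v, D (L_vertex R v) = 0) ->
  forall A, inLG A -> D A = 0.
Proof.
move=> rng_inj rng_surj [DG Dlin DM] De Dv A AG.
have LvD v e A1 : rng e = v -> inLG A1 ->
    L_vertex R v * D A1 = L_edge R e * D (quot e A1).
  move=> ev A1G; have := DM (L_vertex R v) A1 (@inLG_vertex R G v) A1G.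
  rewrite Dv mul0r add0r => <-; have QG := inLG_quot e A1G.
  rewrite (L_vertex_quot rng_inj ev A1G) Dlin; last 2 first.
  - exact: inLG_vertex.
  - by apply: inLGM => //; exact: inLG_edge.
  rewrite Dv scaler0 add0r DM//; last exact: inLG_edge.
  by rewrite De mul0r add0r.
apply: bop_ext => y w; rewrite bopE_0 ell2_0E.
elim/gpath_ind: w A AG => [v|f w fw IHw] A AG.
  have [e ev] := rng_surj v.
  have := congr1 (fun C : B => (C y) (vpath v)) (LvD v e A ev AG).
  by rewrite !bopE_M L_edge_vpath L_vertexE prange_vpath eqxx.
have := congr1 (fun C : B => (C y) (econs fw)) (LvD _ f A erefl AG).
rewrite !bopE_M L_edge_econs eqxx L_vertexE prange_econs eqxx => ->.
by apply: IHw; exact: inLG_quot.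
Qed.

End Division.

(** * Commutants *)

Section Commutants.
Variables (R : realType) (I : choiceType).
Local Notation B := (bop R I).

(** For these operators, commuting with [A] is a family of equations between
    single matrix coefficients of [A], hence a weakly closed condition. *)
Definition monomial_op (C : B) : Prop :=
  forall i, exists (a : R[i]) (j : I), forall y, (C y) i = a * y j.

Lemma monomial_opM C D : monomial_op C -> monomial_op D -> monomial_op (C * D).
Proof.
move=> hC hD i; have [a [j Cj]] := hC i; have [b [k Dk]] := hD j.
by exists (a * b), k => y; rewrite bopE_M Cj Dk mulrA.
Qed.

Lemma monomial_opX C k : monomial_op C -> monomial_op (C ^+ k).
Proof.
move=> hC; elim: k => [|k IHk]; last by rewrite exprS; exact: monomial_opM.
by move=> i; exists 1, i => y; rewrite mul1r.
Qed.

Lemma commutant_closed (C : B) : monomial_op C ->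
  wot_closed [set A | C * A = A * C].
Proof.
move=> hC.
have key y i : wot_closed [set A : B | ((C * A : B) y) i = ((A * C : B) y) i].
  have [a [j Cj]] := hC i.
  have -> : [set A : B | ((C * A : B) y) i = ((A * C : B) y) i] =
      [set A : B | (A (a *: y)) j = (A (C y)) i].
    apply: eq_set => A; congr (_ = _).
    by rewrite bopE_M bop_applyZ ell2ZE Cj.
  by apply: wot_closed_eq; exact: wot_continuous_coord.
have -> : [set A | C * A = A * C] =
    [set A | forall y, forall i, ((C * A : B) y) i = ((A * C : B) y) i].
  apply/seteqP; split=> A h; last exact: bop_ext.
  by move=> y i; rewrite (h : C * A = A * C).
by apply: wot_closed_forall => y; apply: wot_closed_forall => i; exact: key.
Qed.

Lemma pullback_norm (u : I -> option I)
    (u_inj : forall i j k, u i = Some k -> u j = Some k -> i = j) x :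
  ell2_norm (pullback R u_inj x) <= ell2_norm x.
Proof.
rewrite -(@ler_pXn2r _ 2)// ?nnegrE ?ell2_norm_ge0//.
by rewrite -lee_fin !ell2_normE; exact: sqnorm_pullback.
Qed.

End Commutants.

Lemma inLG_central (R : realType) (G : digraph) (C : bop R (gpath G)) :
  monomial_op C ->
  (forall e, C * L_edge R e = L_edge R e * C) ->
  (forall v, C * L_vertex R v = L_vertex R v * C) ->
  forall A, inLG A -> C * A = A * C.
Proof.
move=> hC Ce Cv; apply: inLG_ind => //=.
- by rewrite mulr0 mul0r.
- by move=> a A1 A2 _ _ h1 h2; rewrite mulrDr mulrDl -bop_scaleAr -bop_scaleAl h1 h2.
- by move=> A1 A2 _ _ h1 h2; rewrite mulrA h1 -mulrA h2 mulrA.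
exact: commutant_closed.
Qed.

(** * A circle inside a graph *)

(** The last two clauses say that no other edge of the graph touches the circle,
    so that the circle is a component. *)
Definition circle_at (G : digraph) (n : nat)
    (v : 'I_n -> vertex G) (e : 'I_n -> edge G) : Prop :=
  [/\ injective v, forall i, rng (e i) = v i, forall i, src (e i) = v (ordS i),
      forall f i, rng f = v i -> f = e i & forall f i, src f = v (ordS i) -> f = e i].

Section Circle.
Variables (R : realType) (G : digraph) (n : nat).
Variables (v : 'I_n -> vertex G) (e : 'I_n -> edge G).
Hypothesis ve : circle_at v e.
Local Notation H := (ell2 R (gpath G)).
Local Notation B := (bop R (gpath G)).
Local Notation inLG := (@inLG R G).
Local Notation LE := (@L_edge R G).
Local Notation LV := (@L_vertex R G).
Implicit Types (x y : H) (A C : B) (w : gpath G) (f : edge G) (u : vertex G).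
Implicit Types (i j : 'I_n) (a b : 'I_n -> R[i]).

Let v_inj : injective v. Proof. by case: ve. Qed.
Let rng_e i : rng (e i) = v i. Proof. by case: ve. Qed.
Let src_e i : src (e i) = v (ordS i). Proof. by case: ve. Qed.
Let rng_v f i : rng f = v i -> f = e i. Proof. by case: ve => _ _ _ + _; apply. Qed.
Let src_v f i : src f = v (ordS i) -> f = e i. Proof. by case: ve => _ _ _ _; apply. Qed.

Definition inC u : bool := [exists i, u == v i].

Lemma inCP u : reflect (exists i, u = v i) (inC u).
Proof. by apply: (iffP existsP) => -[i ui]; exists i; apply/eqP. Qed.

Lemma inC_v i : inC (v i). Proof. by apply/inCP; exists i. Qed.

Lemma ordS_inj : injective (@ordS n). Proof. exact: bij_inj (@ordS_bij n). Qed.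

Lemma ordS_surj i : exists j, i = ordS j.
Proof. by have [g _ gK] := @ordS_bij n; exists (g i); rewrite gK. Qed.

Lemma inC_src f : inC (src f) -> exists i, f = e i.
Proof. by move=> /inCP[i fi]; have [j ij] := ordS_surj i; exists j; apply: src_v; rewrite -ij. Qed.

Lemma inC_rng f : inC (rng f) -> exists i, f = e i.
Proof. by move=> /inCP[i fi]; exists i; exact: rng_v. Qed.

Lemma inC_src_rng f : inC (src f) = inC (rng f).
Proof.
apply/idP/idP => [/inC_src[i ->]|/inC_rng[i ->]].
  by rewrite rng_e inC_v.
by rewrite src_e inC_v.
Qed.

Definition cdiag a : B := \sum_i a i *: LV (v i).
Definition cproj : B := cdiag (fun=> 1).
Definition cshift : B := \sum_i LE (e i).
Definition cshift_adj : B := \sum_i L_edge_adj R (e i).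

Lemma cdiagE a x w i : prange w = v i -> (cdiag a x) w = a i * x w.
Proof.
move=> wi; rewrite /cdiag bopE_sum ell2_sumE (bigD1 i)// big1 => [|j ji].
  by rewrite bopE_Z ell2ZE L_vertexE wi eqxx; exact: addr0.
by rewrite bopE_Z ell2ZE L_vertexE wi (inj_eq v_inj) eq_sym (negbTE ji) mulr0.
Qed.

Lemma cdiag0 a x w : ~~ inC (prange w) -> (cdiag a x) w = 0.
Proof.
move=> wC; rewrite /cdiag bopE_sum ell2_sumE big1// => j _.
rewrite bopE_Z ell2ZE L_vertexE; case: eqP => [wj|]; rewrite ?mulr0//.
by rewrite wj inC_v in wC.
Qed.

Lemma cprojE x w : (cproj x) w = if inC (prange w) then x w else 0.
Proof.
by case: ifPn => [/inCP[i wi]|wC]; [rewrite (cdiagE _ _ wi) mul1r|exact: cdiag0].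
Qed.

Lemma cshift_vpath x u : (cshift x) (vpath u) = 0.
Proof. by rewrite /cshift bopE_sum ell2_sumE big1. Qed.

Lemma cshift_econs x w f (fw : src f = prange w) :
  (cshift x) (econs fw) = if inC (rng f) then x w else 0.
Proof.
rewrite /cshift bopE_sum ell2_sumE; case: ifPn => [/inC_rng[i fi]|fC].
  rewrite (bigD1 i)// big1 => [|j ji].
    by rewrite L_edge_econs fi eqxx; exact: addr0.
  rewrite L_edge_econs fi; case: eqP => // eij.
  by move: ji; rewrite -(inj_eq v_inj) -!rng_e eij eqxx.
rewrite big1// => j _; rewrite L_edge_econs; case: eqP => // fj.
by rewrite fj rng_e inC_v in fC.
Qed.

Lemma cshift_adjE x w i (ew : src (e i) = prange w) :
  (cshift_adj x) w = x (econs ew).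
Proof.
rewrite /cshift_adj bopE_sum ell2_sumE (bigD1 i)// big1 => [|j ji].
  by rewrite L_edge_adjE; exact: addr0.
apply: L_edge_adj0; rewrite -ew !src_e (inj_eq v_inj).
by rewrite (inj_eq ordS_inj).
Qed.

Lemma cshift_adj0 x w : ~~ inC (prange w) -> (cshift_adj x) w = 0.
Proof.
move=> wC; rewrite /cshift_adj bopE_sum ell2_sumE big1// => i _.
by apply: L_edge_adj0; apply: contraNneq wC => <-; rewrite src_e inC_v.
Qed.

Lemma inLG_cdiag a : inLG (cdiag a).
Proof. by apply: inLG_sum => i; apply: inLGZ; exact: inLG_vertex. Qed.

Lemma inLG_cproj : inLG cproj. Proof. exact: inLG_cdiag. Qed.

Lemma inLG_cshift : inLG cshift.
Proof. by apply: inLG_sum => i; exact: inLG_edge. Qed.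

Lemma inLG_cshiftX k : inLG (cproj * cshift ^+ k).
Proof.
elim: k => [|k IHk]; first by rewrite expr0 mulr1; exact: inLG_cproj.
by rewrite exprSr mulrA; apply: inLGM => //; exact: inLG_cshift.
Qed.

Lemma cdiagM a b : cdiag a * cdiag b = cdiag (fun i => a i * b i).
Proof.
apply: bop_ext => x w; rewrite bopE_M.
case: (boolP (inC (prange w))) => [/inCP[i wi]|wC]; last by rewrite !cdiag0.
by rewrite !(cdiagE _ _ wi) mulrA.
Qed.

Lemma cdiagP a : cdiag a * cproj = cdiag a.
Proof. by rewrite cdiagM; congr cdiag; apply/funext => i; rewrite mulr1. Qed.

Lemma cprojD a : cproj * cdiag a = cdiag a.
Proof. by rewrite cdiagM; congr cdiag; apply/funext => i; rewrite mul1r. Qed.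

Lemma cproj_shift : cproj * cshift = cshift.
Proof.
apply: bop_ext => x w; rewrite bopE_M cprojE; case: ifPn => // wC.
elim/gpath_ind: w wC => [u|f w fw _] wC; first by rewrite cshift_vpath.
by rewrite cshift_econs -[rng f](prange_econs fw) (negbTE wC).
Qed.

Lemma cshift_diag a : cshift * cdiag a = cdiag (a \o @ordS n) * cshift.
Proof.
apply: bop_ext => x w; rewrite !bopE_M.
case: (boolP (inC (prange w))) => [/inCP[i wi]|wC]; last first.
  by rewrite cdiag0// -[cshift in LHS]cproj_shift bopE_M cprojE (negbTE wC).
rewrite (cdiagE _ _ wi); elim/gpath_ind: w wi => [u|f w fw _] wi.
  by rewrite !cshift_vpath mulr0.
have fi : f = e i by exact: rng_v.
rewrite !cshift_econs; case: ifP => _; rewrite ?mulr0//.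
by apply: cdiagE; rewrite -fw fi src_e.
Qed.

Lemma cshift_proj : cshift * cproj = cshift.
Proof. by rewrite cshift_diag -[RHS]cproj_shift. Qed.

Lemma cproj_shiftX k : cproj * cshift ^+ k = cshift ^+ k * cproj.
Proof.
by apply: commrX; rewrite /GRing.comm cproj_shift cshift_proj.
Qed.

Lemma cshift_adjK : cshift_adj * cshift = cproj.
Proof.
apply: bop_ext => x w; rewrite bopE_M cprojE; case: ifPn => [/inCP[i wi]|wC].
  have [j ij] := ordS_surj i.
  have ew : src (e j) = prange w by rewrite src_e -ij wi.
  by rewrite (cshift_adjE _ ew) cshift_econs rng_e inC_v.
by rewrite cshift_adj0.
Qed.

Lemma cshift_adjXK k : cshift_adj ^+ k * cshift ^+ k * cproj = cproj.
Proof.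
elim: k => [|k IHk]; first by rewrite !expr0 !mul1r.
have -> : cshift_adj ^+ k.+1 * cshift ^+ k.+1 =
    cshift_adj ^+ k * (cproj * cshift ^+ k).
  by rewrite exprSr exprS -!mulrA (mulrA cshift_adj) cshift_adjK.
have PP : cproj * cproj = cproj by exact: cdiagP.
by rewrite cproj_shiftX mulrA -mulrA PP.
Qed.

(** Once its degree-zero part vanishes, an element supported on the circle is a
    left multiple of [cshift]: the division lemma applies edge by edge. *)
Lemma cshift_divK X : cproj * X = X -> (forall i, chi (v i) X = 0) -> inLG X ->
  [/\ inLG (cshift_adj * X), cshift * (cshift_adj * X) = X &
      cproj * (cshift_adj * X) = cshift_adj * X].
Proof.
move=> PX X0 XG; split.
- rewrite /cshift_adj mulr_suml; apply: inLG_sum => i.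
  have := inLG_quot (e i) XG.
  by rewrite /quot rng_e X0 scale0r subr0.
- apply: bop_ext => x w; rewrite !bopE_M.
  elim/gpath_ind: w => [u|f w fw _].
    rewrite cshift_vpath -PX bopE_M cprojE prange_vpath.
    by case: ifP => // /inCP[i ->]; rewrite inLG_chi// X0 mul0r.
  rewrite cshift_econs; case: ifPn => [/inC_rng[i fi]|fC].
    by subst f; rewrite (cshift_adjE _ fw).
  by rewrite -PX bopE_M cprojE prange_econs (negbTE fC).
- apply: bop_ext => x w; rewrite !bopE_M cprojE.
  by case: ifPn => // wC; rewrite cshift_adj0.
Qed.

Lemma L_vertex_cdiag i : LV (v i) = cdiag (fun j => (j == i)%:R).
Proof.
rewrite /cdiag (bigD1 i)//= eqxx scale1r big1 ?addr0// => j /negbTE ->.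
by rewrite scale0r.
Qed.

Lemma L_edge_cshift i : LE (e i) = LV (v i) * cshift.
Proof.
apply: bop_ext => x w; rewrite bopE_M L_vertexE.
elim/gpath_ind: w => [u|f w fw _].
  by rewrite L_edge_vpath cshift_vpath if_same.
rewrite L_edge_econs cshift_econs prange_econs.
case: (eqVneq (rng f) (v i)) => [fi|fi].
  by rewrite (rng_v fi) rng_e inC_v eqxx.
by case: eqP => // fe; rewrite fe rng_e eqxx in fi.
Qed.

(** * Central elements of a circle *)

Lemma cproj_vertex u : cproj * LV u = (inC u)%:R *: LV u.
Proof.
apply: bop_ext => x w; rewrite bopE_M cprojE bopE_Z ell2ZE !L_vertexE.
by case: eqP => [->|]; case: inC; rewrite ?mul1r ?mul0r ?mulr0.
Qed.

Lemma vertex_cproj u : LV u * cproj = (inC u)%:R *: LV u.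
Proof.
apply: bop_ext => x w; rewrite bopE_M bopE_Z ell2ZE !L_vertexE cprojE.
by case: eqP => [->|]; case: inC; rewrite ?mul1r ?mul0r ?mulr0.
Qed.

Lemma cproj_edge f : cproj * LE f = (inC (rng f))%:R *: LE f.
Proof.
apply: bop_ext => x w; rewrite bopE_M cprojE bopE_Z ell2ZE.
elim/gpath_ind: w => [u|f' w fw _]; first by rewrite L_edge_vpath mulr0 if_same.
rewrite L_edge_econs prange_econs.
by case: eqP => [->|]; case: inC; rewrite ?mul1r ?mul0r ?mulr0.
Qed.

Lemma edge_cproj f : LE f * cproj = (inC (rng f))%:R *: LE f.
Proof.
apply: bop_ext => x w; rewrite bopE_M bopE_Z ell2ZE.
elim/gpath_ind: w => [u|f' w fw _]; first by rewrite !L_edge_vpath mulr0.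
rewrite !L_edge_econs; case: eqP => [ff'|]; rewrite ?mulr0//.
rewrite cprojE -fw ff' inC_src_rng.
by case: inC; rewrite ?mul1r ?mul0r.
Qed.

Lemma monomial_cproj : monomial_op cproj.
Proof.
move=> w; exists (inC (prange w))%:R, w => y; rewrite cprojE.
by case: inC; rewrite ?mul1r ?mul0r.
Qed.

Lemma monomial_cshift : monomial_op cshift.
Proof.
elim/gpath_ind => [u|f w fw _].
  by exists 0, (vpath u) => y; rewrite cshift_vpath mul0r.
exists (inC (rng f))%:R, w => y; rewrite cshift_econs.
by case: inC; rewrite ?mul1r ?mul0r.
Qed.

Lemma cproj_central A : inLG A -> cproj * A = A * cproj.
Proof.
apply: inLG_central; first exact: monomial_cproj.
  by move=> f; rewrite cproj_edge edge_cproj.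
by move=> u; rewrite cproj_vertex vertex_cproj.
Qed.

Lemma iter_ordS k i : val (iter k (@ordS n) i) = ((i + k) %% n)%N.
Proof.
elim: k => [|k IHk]; first by rewrite addn0 modn_small.
by rewrite iterS /= IHk addnS -addn1 modnDml addn1.
Qed.

Lemma cshiftX_diag k a :
  cshift ^+ k * cdiag a = cdiag (a \o iter k (@ordS n)) * cshift ^+ k.
Proof.
elim: k a => [|k IHk] a; first by rewrite !expr0 mulr1 mul1r.
rewrite exprSr -mulrA cshift_diag mulrA IHk -mulrA.
by congr (cdiag _ * _).
Qed.

(** The shift permutes the vertex projections, but a full turn returns to the same
    vertex and therefore gives a central element. *)
Definition ccycle : B := cshift ^+ n.

Lemma ccycle_diag a : ccycle * cdiag a = cdiag a * ccycle.
Proof.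
rewrite /ccycle cshiftX_diag; congr (cdiag _ * _); apply/funext => i /=.
congr (a _); apply: val_inj => /=.
by rewrite iter_ordS modnDr modn_small.
Qed.

Lemma ccycle_shift : ccycle * cshift = cshift * ccycle.
Proof. by rewrite /ccycle -exprSr -exprS. Qed.

Hypothesis n_gt0 : (0 < n)%N.

Lemma ccycle_proj : ccycle * cproj = ccycle.
Proof. by rewrite /ccycle -(prednK n_gt0) exprSr -mulrA cshift_proj. Qed.

Lemma cproj_cycle : cproj * ccycle = ccycle.
Proof. by rewrite cproj_shiftX ccycle_proj. Qed.

Lemma ccycle_central A : inLG A -> ccycle * A = A * ccycle.
Proof.
have vP u : ~~ inC u -> cproj * LV u = 0 /\ LV u * cproj = 0.
  by move=> /negbTE uC; rewrite cproj_vertex vertex_cproj uC !scale0r.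
have eP f : ~~ inC (rng f) -> cproj * LE f = 0 /\ LE f * cproj = 0.
  by move=> /negbTE fC; rewrite cproj_edge edge_cproj fC !scale0r.
have vZ u : ccycle * LV u = LV u * ccycle.
  case: (boolP (inC u)) => [/inCP[i ->]|/vP[Pu uP]].
    by rewrite L_vertex_cdiag ccycle_diag.
  by rewrite -{1}ccycle_proj -mulrA Pu mulr0 -cproj_cycle mulrA uP mul0r.
apply: inLG_central => // [|f]; first exact/monomial_opX/monomial_cshift.
case: (boolP (inC (rng f))) => [/inC_rng[i ->]|/eP[Pf fP]].
  by rewrite L_edge_cshift mulrA vZ -!mulrA ccycle_shift.
by rewrite -{1}ccycle_proj -mulrA Pf mulr0 -cproj_cycle mulrA fP mul0r.
Qed.

Lemma inLG_ccycle : inLG ccycle.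
Proof. by rewrite -cproj_cycle; exact: inLG_cshiftX. Qed.

(** * Norms of the operators of a circle *)

Lemma cdiag_norm a x : (forall i, cabs (a i) <= 1) ->
  ell2_norm (cdiag a x) <= ell2_norm x.
Proof.
move=> a1; apply: ell2_norm_le_pointwise => w.
case: (boolP (inC (prange w))) => [/inCP[i wi]|wC].
  by rewrite (cdiagE _ _ wi) cabsM ler_piMl ?cabs_ge0.
by rewrite cdiag0// cabs0 cabs_ge0.
Qed.

(** [cuncons] and [ccons] exhibit the shift and its adjoint as pullbacks along
    partial injections, from which they inherit contractivity. *)
Definition cuncons w : option (gpath G) :=
  if inC (prange w) then
    if (val w).2 is f :: q then insub (src f, q) else None
  else None.

Lemma cuncons_vpath u : cuncons (vpath u) = None.
Proof. by rewrite /cuncons if_same. Qed.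

Lemma cuncons_econs w f (fw : src f = prange w) :
  cuncons (econs fw) = if inC (rng f) then Some w else None.
Proof.
rewrite /cuncons prange_econs; case: ifP => // _ /=.
rewrite insubT => [|h]; first by rewrite /= fw; exact: (valP w).
congr Some; apply: val_inj => /=.
by rewrite [RHS]surjective_pairing fw.
Qed.

Lemma cuncons_inj w1 w2 w : cuncons w1 = Some w -> cuncons w2 = Some w -> w1 = w2.
Proof.
elim/gpath_ind: w1 => [u|f1 w1 fw1 _]; first by rewrite cuncons_vpath.
elim/gpath_ind: w2 => [u|f2 w2 fw2 _]; first by rewrite cuncons_vpath.
rewrite !cuncons_econs; case: ifP => // /inC_rng[i fi] [ww1].
case: ifP => // /inC_rng[j fj] [ww2]; subst w1 w2 f1 f2.
have : v (ordS i) = v (ordS j) by rewrite -!src_e fw1 fw2.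
by move=> /v_inj/ordS_inj ij; subst j; exact: val_inj.
Qed.

Lemma cshift_norm x : ell2_norm (cshift x) <= ell2_norm x.
Proof.
rewrite (_ : cshift x = pullback R cuncons_inj x); first exact: pullback_norm.
apply: ell2_ext => w; rewrite [RHS]/= /pullback_fun.
elim/gpath_ind: w => [u|f w fw _].
  by rewrite cshift_vpath cuncons_vpath.
by rewrite cshift_econs cuncons_econs; case: ifP.
Qed.

Definition ccons w : option (gpath G) :=
  if [pick i | prange w == v (ordS i)] is Some i then epush (e i) w else None.

Lemma ccons_inj w1 w2 w : ccons w1 = Some w -> ccons w2 = Some w -> w1 = w2.
Proof.
rewrite /ccons; case: pickP => // i _ /epushP[h1 ->].
by case: pickP => // j _ /epushP[h2 /econs_inj[]].
Qed.

Lemma cshift_adj_norm x : ell2_norm (cshift_adj x) <= ell2_norm x.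
Proof.
rewrite (_ : cshift_adj x = pullback R ccons_inj x); first exact: pullback_norm.
apply: ell2_ext => w; rewrite [RHS]/= /pullback_fun /ccons.
case: pickP => [i /eqP wi|wC].
  have ew : src (e i) = prange w by rewrite src_e wi.
  by rewrite (cshift_adjE _ ew) (epushE ew).
rewrite cshift_adj0//; apply/negP => /inCP[i wi]; have [j ij] := ordS_surj i.
by have := wC j; rewrite wi ij eqxx.
Qed.

Lemma cshiftX_norm k x : ell2_norm ((cshift ^+ k) x) <= ell2_norm x.
Proof.
elim: k x => [|k IHk] x; first by rewrite expr0.
by rewrite exprS bopE_M; apply: le_trans (cshift_norm _) _.
Qed.

Lemma cshift_adjX_norm k x : ell2_norm ((cshift_adj ^+ k) x) <= ell2_norm x.
Proof.
elim: k x => [|k IHk] x; first by rewrite expr0.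
by rewrite exprS bopE_M; apply: le_trans (cshift_adj_norm _) _.
Qed.

End Circle.

(** * Derivations *)

Section Derivations.
Variables (R : realType) (G : digraph).
Local Notation B := (bop R (gpath G)).
Local Notation inLG := (@inLG R G).
Variable D : B -> B.
Hypothesis derD : is_der D.
Implicit Types (A C P Z : B).

Lemma der_inLG A : inLG A -> inLG (D A). Proof. by case: derD => + _ _; apply. Qed.

Lemma der_lin (a : R[i]) A C : inLG A -> inLG C -> D (a *: A + C) = a *: D A + D C.
Proof. by case: derD => _ + _; apply. Qed.

Lemma derM A C : inLG A -> inLG C -> D (A * C) = D A * C + A * D C.
Proof. by case: derD => _ _; apply. Qed.

Lemma der0 : D 0 = 0.
Proof.
have := der_lin (-1) (@inLG0 R G) (@inLG0 R G).
by rewrite scaler0 addr0 scaleN1r addNr.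
Qed.

Lemma der_add A C : inLG A -> inLG C -> D (A + C) = D A + D C.
Proof. by move=> hA hC; have := der_lin 1 hA hC; rewrite !scale1r. Qed.

Lemma derZ (a : R[i]) A : inLG A -> D (a *: A) = a *: D A.
Proof. by move=> hA; have := der_lin a hA (@inLG0 R G); rewrite der0 !addr0. Qed.

Lemma derB A C : inLG A -> inLG C -> D (A - C) = D A - D C.
Proof.
by move=> hA hC; rewrite -scaleN1r der_add//; [rewrite derZ// scaleN1r|exact: inLGZ].
Qed.

Lemma der_sum (J : Type) (r : seq J) (f : J -> B) : (forall j, inLG (f j)) ->
  D (\sum_(j <- r) f j) = \sum_(j <- r) D (f j).
Proof.
move=> fG; elim: r => [|j r IHr]; first by rewrite !big_nil der0.
by rewrite !big_cons der_add ?IHr//; exact: inLG_sum.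
Qed.

(** Multiplying [D P = P D P + D P P = 2 P D P] by [P] shows [P D P = 0]. *)
Lemma der_central_idem P : inLG P -> P * P = P ->
  (forall A, inLG A -> P * A = A * P) -> D P = 0.
Proof.
move=> PG PP Pc; have h := derM PG PG; rewrite PP -Pc in h; last exact: der_inLG.
have PDP : P * D P = 0.
  have := congr1 (fun A => P * A) h.
  rewrite /= mulrDr mulrA PP => /eqP.
  by rewrite -subr_eq0 opprD addrA subrr add0r oppr_eq0 => /eqP.
by rewrite h PDP addr0.
Qed.

Lemma der_powS Z : inLG Z -> (forall A, inLG A -> Z * A = A * Z) ->
  forall k, D (Z ^+ k.+1) = (k.+1)%:R *: (Z ^+ k * D Z).
Proof.
move=> ZG Zc; have ZXG k : inLG (Z ^+ k.+1).
  by elim: k => [|k IHk]; [rewrite expr1|rewrite exprS; exact: inLGM].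
elim=> [|k IHk]; first by rewrite expr1 expr0 mul1r scale1r.
rewrite exprS derM// IHk -bop_scaleAr mulrA -exprS.
have -> : D Z * Z ^+ k.+1 = Z ^+ k.+1 * D Z.
  exact: commrX (esym (Zc _ (der_inLG ZG))).
by set U := _ * D Z; rewrite -[X in X + _]scale1r -scalerDl addrC natr1.
Qed.

End Derivations.

(** * Coefficients along a circle *)

Section CircleDerivation.
Variables (R : realType) (G : digraph) (n : nat).
Variables (v : 'I_n -> vertex G) (e : 'I_n -> edge G).
Hypothesis ve : circle_at v e.
Hypothesis n_gt0 : (0 < n)%N.
Local Notation H := (ell2 R (gpath G)).
Local Notation B := (bop R (gpath G)).
Local Notation inLG := (@inLG R G).
Local Notation LE := (@L_edge R G).
Local Notation LV := (@L_vertex R G).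
Local Notation inC := (inC v).
Local Notation P := (cproj R v).
Local Notation S := (cshift R e).
Local Notation S' := (cshift_adj R e).
Local Notation Z := (ccycle R e).
Local Notation diag := (@cdiag R G n v).
Implicit Types (x y : H) (A C : B) (w : gpath G) (f : edge G) (u : vertex G).
Implicit Types (i j : 'I_n) (a b : 'I_n -> R[i]).

(** The path [w] lengthened at its range by the next edge of the circle. The
    default value only matters away from the circle. *)
Definition tau w : gpath G := odflt w (ccons v e w).

Lemma tauP w i : prange w = v (ordS i) ->
  exists ew : src (e i) = prange w, tau w = econs ew.
Proof.
case: (ve) => v_inj rng_e src_e _ _ wi.
have ew : src (e i) = prange w by rewrite src_e wi.
exists ew; rewrite /tau /ccons; case: pickP => [j|/(_ i)]; last by rewrite wi eqxx.
rewrite wi (inj_eq v_inj) (inj_eq (@ordS_inj n)) => /eqP ij; subst j.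
by rewrite (epushE ew).
Qed.

Lemma inC_ordS u : inC u -> exists i, u = v (ordS i).
Proof. by move=> /inCP[i ui]; have [j ij] := ordS_surj i; exists j; rewrite -ij. Qed.

Lemma inC_tau w : inC (prange w) -> inC (prange (tau w)).
Proof.
move=> /inC_ordS[i /tauP[ew ->]]; case: (ve) => _ rng_e _ _ _.
by rewrite prange_econs rng_e inC_v.
Qed.

Lemma plen_tau w : inC (prange w) -> plen (tau w) = (plen w).+1.
Proof. by move=> /inC_ordS[i /tauP[ew ->]]. Qed.

Lemma cshift_tau x w : inC (prange w) -> (S x) (tau w) = x w.
Proof.
move=> /inC_ordS[i /tauP[ew ->]]; case: (ve) => _ rng_e _ _ _.
by rewrite (cshift_econs ve) rng_e inC_v.
Qed.

Lemma cshift_adj_tau x w : inC (prange w) -> (S' x) w = x (tau w).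
Proof. by move=> /inC_ordS[i /tauP[ew ->]]; exact: (cshift_adjE ve x ew). Qed.

Lemma inC_iter_tau k w : inC (prange w) -> inC (prange (iter k tau w)).
Proof. by move=> wC; elim: k => //= k; exact: inC_tau. Qed.

Lemma plen_iter_tau k w : inC (prange w) -> plen (iter k tau w) = (k + plen w)%N.
Proof.
by move=> wC; elim: k => //= k IHk; rewrite plen_tau ?IHk// inC_iter_tau.
Qed.

Lemma cshiftX_tau k l x w : inC (prange w) ->
  ((S ^+ k) x) (iter (k + l) tau w) = x (iter l tau w).
Proof.
move=> wC; elim: k x => [|k IHk] x; first by rewrite expr0.
by rewrite exprS bopE_M addSn /= cshift_tau ?inC_iter_tau.
Qed.

Lemma cshift_adjX_tau k x w : inC (prange w) ->
  ((S' ^+ k) x) w = x (iter k tau w).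
Proof.
elim: k x w => [|k IHk] x w wC; first by rewrite expr0.
by rewrite exprS bopE_M cshift_adj_tau// IHk ?inC_tau// -iterSr.
Qed.

Lemma cshiftX_short k x w : (plen w < k)%N -> ((S ^+ k) x) w = 0.
Proof.
elim: k x w => // k IHk x; elim/gpath_ind => [u|f w fw _] wk.
  by rewrite exprS bopE_M cshift_vpath.
rewrite exprS bopE_M (cshift_econs ve); case: ifP => // _.
exact: IHk.
Qed.

(** The hypothesis says that no coefficient of degree less than [N] survives. *)
Lemma cshift_divXK N A : inLG A -> P * A = A ->
  (forall k i, (k < N)%N -> chi (v i) (S' ^+ k * A) = 0) ->
  [/\ inLG (S' ^+ N * A), S ^+ N * (S' ^+ N * A) = A &
      P * (S' ^+ N * A) = S' ^+ N * A].
Proof.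
move=> AG PA; elim: N => [|N IHN] A0; first by rewrite !expr0 !mul1r.
have [IG IK IP] := IHN (fun k i kN => A0 k i (ltnW kN)).
have [IG' IK' IP'] := cshift_divK ve IP (fun i => A0 N i (ltnSn N)) IG.
rewrite [S' ^+ _]exprS -[S' * _ * A]mulrA; split => //.
by rewrite exprSr -mulrA IK'.
Qed.

Lemma chi_cshift_adjX k i A :
  chi (v i) (S' ^+ k * A) = (A (xi R (vpath (v i)))) (iter k tau (vpath (v i))).
Proof. by rewrite /chi bopE_M cshift_adjX_tau// prange_vpath inC_v. Qed.

(** After [k] steps the range has moved [k] vertices backwards. *)
Lemma prange_iter_tau k i :
  exists2 j, prange (iter k tau (vpath (v i))) = v j & iter k (@ordS n) j = i.
Proof.
elim: k => [|k [j jv ji]]; first by exists i.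
have [l jl] := ordS_surj j; rewrite jl in jv ji.
have [ew /= ->] := tauP jv; case: (ve) => _ rng_e _ _ _.
by exists l; [rewrite prange_econs rng_e|rewrite -iterS iterSr].
Qed.

Variable D : B -> B.
Hypothesis derD : is_der D.

Let PG : inLG P. Proof. exact: inLG_cproj. Qed.
Let SG : inLG S. Proof. exact: inLG_cshift. Qed.
Let ZG : inLG Z. Proof. exact: inLG_ccycle ve n_gt0. Qed.
Let PP : P * P = P. Proof. exact: cdiagP ve _. Qed.
Let Pc A : inLG A -> P * A = A * P. Proof. by move=> AG; rewrite (cproj_central ve AG). Qed.
Let Zc A : inLG A -> Z * A = A * Z. Proof. by move=> AG; rewrite (ccycle_central ve n_gt0 AG). Qed.

Lemma der_cproj A : inLG A -> D (P * A) = P * D A.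
Proof.
by move=> AG; rewrite derM// (der_central_idem derD PG PP Pc) mul0r add0r.
Qed.

Lemma der_cprojK A : inLG A -> P * A = A -> P * D A = D A.
Proof. by move=> AG PA; rewrite -der_cproj// PA. Qed.

End CircleDerivation.

(** * A lacunary series in the cycle *)

Section LacunaryExponents.
Variables (R : realType) (b : nat).
Hypothesis b_gt1 : (1 < b)%N.

(** The exponents grow so fast that the coefficient [lac_coef j] of the series
    becomes [b ^ j] in its derivative. *)
Definition lac_exp j : nat := ((2 * b) ^ j)%N.
Definition lac_coef j : R := 2^-1 ^+ j.

Lemma lac_exp_gt0 j : (0 < lac_exp j)%N.
Proof. by rewrite expn_gt0 muln_gt0 (ltnW b_gt1). Qed.

Lemma lac_exp_gt j : (j < lac_exp j)%N.
Proof. by apply: ltn_expl; rewrite mul2n -addnn; lia. Qed.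

Lemma lac_exp_mono i j : (i <= j)%N -> (lac_exp i <= lac_exp j)%N.
Proof. by move=> ij; apply: leq_pexp2l => //; rewrite muln_gt0 (ltnW b_gt1). Qed.

Lemma lac_exp_gap j : (lac_exp j + b <= lac_exp j.+1)%N.
Proof. by rewrite /lac_exp expnS; have := lac_exp_gt0 j; rewrite /lac_exp; nia. Qed.

Lemma lac_coef_exp j : (lac_coef j)%:C * (lac_exp j)%:R = (b%:R ^+ j)%:C :> R[i].
Proof.
have -> : ((lac_exp j)%:R : R[i]) = ((lac_exp j)%:R : R)%:C by rewrite rmorph_nat.
rewrite -rmorphM; congr (_%:C).
by rewrite /lac_coef /lac_exp natrX natrM -exprMn mulrA mulVf ?mul1r.
Qed.

End LacunaryExponents.

Section CycleDerivative.
Variables (R : realType) (G : digraph) (n : nat).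
Variables (v : 'I_n -> vertex G) (e : 'I_n -> edge G).
Hypothesis ve : circle_at v e.
Hypothesis n_gt0 : (0 < n)%N.
Local Notation H := (ell2 R (gpath G)).
Local Notation B := (bop R (gpath G)).
Local Notation inLG := (@inLG R G).
Local Notation inC := (inC v).
Local Notation P := (cproj R v).
Local Notation S := (cshift R e).
Local Notation S' := (cshift_adj R e).
Local Notation Z := (ccycle R e).
Local Notation tau := (tau v e).
Implicit Types (x y : H) (A C : B) (w : gpath G).

Lemma ccycleX m : Z ^+ m = S ^+ (n * m). Proof. by rewrite /ccycle -exprM. Qed.

Lemma ccycleX_short m x w : (plen w < n * m)%N -> ((Z ^+ m) x) w = 0.
Proof. by rewrite ccycleX => h; exact: (cshiftX_short ve x h). Qed.

Lemma cproj_cycleX m : P * Z ^+ m.+1 = Z ^+ m.+1.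
Proof. by rewrite exprS mulrA (@cproj_cycle _ _ _ _ _ ve n_gt0). Qed.

Lemma inLG_ccycleX m : inLG (Z ^+ m.+1).
Proof.
elim: m => [|m IHm]; first by rewrite expr1; exact: inLG_ccycle ve n_gt0.
by rewrite exprS; apply: inLGM => //; exact: inLG_ccycle ve n_gt0.
Qed.

Variable b : nat.
Hypothesis b_gt1 : (1 < b)%N.
Local Notation lac_exp := (lac_exp b).
Local Notation lac_coef := (lac_coef R).

Definition lac_sum J : B := \sum_(j < J) (lac_coef j)%:C *: Z ^+ lac_exp j.

Lemma lac_sumE J x w :
  (lac_sum J x) w = \sum_(j < J) (lac_coef j)%:C * ((Z ^+ lac_exp j) x) w.
Proof. by rewrite /lac_sum bopE_sum ell2_sumE. Qed.

Lemma lac_sum_stat J L x w : (plen w < n * lac_exp J)%N -> (J <= L)%N ->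
  (lac_sum L x) w = (lac_sum J x) w.
Proof.
move=> wJ JL; rewrite -(subnKC JL); elim: (L - J)%N => [|m IHm]; first by rewrite addn0.
rewrite addnS /lac_sum big_ord_recr -/(lac_sum _) bopE_D ell2DE IHm.
rewrite [X in _ + X](_ : _ = 0); first exact: addr0.
rewrite bopE_Z ell2ZE ccycleX_short ?mulr0//.
by apply: leq_trans wJ _; rewrite leq_mul2l (lac_exp_mono b_gt1) ?orbT// leq_addr.
Qed.

Lemma lac_sum_norm J x : ell2_norm (lac_sum J x) <= 2 * ell2_norm x.
Proof.
rewrite /lac_sum bopE_sum; apply: le_trans (ell2_norm_sum _ _) _.
have half_sum : \sum_(j < J) lac_coef j <= 2.
  suff -> : \sum_(j < J) lac_coef j = 2 - 2 * lac_coef J.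
    by rewrite gerBl mulr_ge0// exprn_ge0.
  elim: J => [|J IHJ]; first by rewrite big_ord0 /lac_coef expr0 mulr1 subrr.
  by rewrite big_ord_recr /= IHJ /lac_coef exprS; field.
apply: (@le_trans _ _ (\sum_(j < J) lac_coef j * ell2_norm x)).
  apply: ler_sum => j _; rewrite bopE_Z ell2_normZE cabs_real.
  rewrite ger0_norm ?exprn_ge0//; apply: ler_wpM2l; first exact: exprn_ge0.
  by rewrite ccycleX; exact: (cshiftX_norm ve).
by rewrite -mulr_suml ler_wpM2r// ell2_norm_ge0.
Qed.

Lemma inLG_lac_term j : inLG (Z ^+ lac_exp j).
Proof. by rewrite -(prednK (lac_exp_gt0 b_gt1 j)); exact: inLG_ccycleX. Qed.

Lemma inLG_lac_sum J : inLG (lac_sum J).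
Proof. by apply: inLG_sum => j; apply: inLGZ; exact: inLG_lac_term. Qed.

(** The partial sums are uniformly bounded by the sum of the coefficients, and a
    coordinate at a path only sees the terms of degree at most its length. *)
Lemma lac_series : exists F : B, inLG F /\
  forall J x w, (plen w < n * lac_exp J)%N -> (F x) w = (lac_sum J x) w.
Proof.
have wE w : (plen w < n * lac_exp (plen w).+1)%N.
  by apply: leq_trans (leq_pmull _ n_gt0); apply: ltnW; exact: (lac_exp_gt b_gt1).
have [x w|F [FG Fg _]] := @inLG_limit R G nat \oo _ lac_sum 2
  (fun x w => (lac_sum (plen w).+1 x) w) (ler0n R 2) inLG_lac_sum lac_sum_norm.
  by exists (plen w).+1 => // J /= wJ; exact: lac_sum_stat.
exists F; split => // J x w wJ; rewrite Fg.
by have [h|/ltnW h] := leqP J (plen w).+1;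
  rewrite (@lac_sum_stat _ _ x w _ h)// lac_sum_stat.
Qed.

Variable D : B -> B.
Hypothesis derD : is_der D.

Let ZG : inLG Z. Proof. exact: inLG_ccycle ve n_gt0. Qed.
Let Zc A : inLG A -> Z * A = A * Z.
Proof. by move=> AG; rewrite (ccycle_central ve n_gt0 AG). Qed.

Lemma der_lac_sum J y w : (D (lac_sum J) y) w =
  \sum_(j < J) (b%:R ^+ j)%:C * ((Z ^+ (lac_exp j).-1) (D Z y)) w.
Proof.
rewrite /lac_sum der_sum// => [|j]; last by apply: inLGZ; exact: inLG_lac_term.
rewrite bopE_sum ell2_sumE; apply: eq_bigr => j _.
rewrite derZ//; last exact: inLG_lac_term.
rewrite bopE_Z ell2ZE -{1}(prednK (lac_exp_gt0 b_gt1 j)) (der_powS derD ZG Zc).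
by rewrite bopE_Z ell2ZE bopE_M prednK ?(lac_exp_gt0 b_gt1)// mulrA lac_coef_exp.
Qed.

(** The remainder of the series is divisible by a high power of [Z], and the
    derivation lowers this power by at most one; so the algebraic Leibniz rule
    determines the derivative of the infinite sum degree by degree. *)
Lemma der_lac_series F J y w : inLG F ->
  (forall J x w, (plen w < n * lac_exp J)%N -> (F x) w = (lac_sum J x) w) ->
  (plen w < n * (lac_exp J).-1)%N -> (D F y) w = (D (lac_sum J) y) w.
Proof.
move=> FG Flac wJ; pose A := F - lac_sum J.
have AG : inLG A by apply: inLGB => //; exact: inLG_lac_sum.
have Ashort x u : (plen u < n * lac_exp J)%N -> (A x) u = 0.
  by move=> uJ; rewrite bopE_B ell2BE (Flac J)// subrr.
have lacP L x u : ~~ inC (prange u) -> (lac_sum L x) u = 0.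
  move=> uC; rewrite lac_sumE big1// => j _.
  rewrite -(prednK (lac_exp_gt0 b_gt1 j)) -cproj_cycleX bopE_M (cprojE ve) (negbTE uC).
  exact: mulr0.
have PA : P * A = A.
  apply: bop_ext => x u; rewrite bopE_M (cprojE ve); case: ifPn => // uC.
  rewrite bopE_B ell2BE lacP// (Flac (plen u).+1).
    by rewrite lacP// subrr.
  by apply: leq_trans (leq_pmull _ n_gt0); apply: ltnW; exact: (lac_exp_gt b_gt1).
have [kN|A'G A'K _] := cshift_divXK ve (N := n * lac_exp J) AG PA.
  move=> i hk; rewrite (chi_cshift_adjX ve) Ashort//.
  by rewrite (plen_iter_tau ve) ?addn0// prange_vpath inC_v.
set A' := S' ^+ _ * A in A'G A'K.
have DA : (D A y) w = 0.
  rewrite -A'K -ccycleX derM//; last exact: inLG_lac_term.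
  rewrite -(prednK (lac_exp_gt0 b_gt1 J)) (der_powS derD ZG Zc) bopE_D !bopE_M bopE_Z.
  rewrite ell2DE ell2ZE bopE_M ccycleX_short// mulr0 add0r.
  apply: ccycleX_short; apply: leq_trans wJ _.
  by rewrite leq_mul2l leqnSn orbT.
apply/eqP; rewrite -subr_eq0; apply/eqP.
by rewrite -ell2BE -bopE_B -derB//; exact: inLG_lac_sum.
Qed.

End CycleDerivative.

(** If [D Z] were not zero, then [D] would map the lacunary series
    [sum_j 2^-j Z^k_j] to [(sum_j 2^-j k_j Z^(k_j - 1)) (D Z)],
    whose coefficients are unbounded. *)
Lemma der_ccycle (R : realType) (G : digraph) (n : nat)
    (v : 'I_n -> vertex G) (e : 'I_n -> edge G) (D : bop R (gpath G) -> bop R (gpath G)) :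
  circle_at v e -> (0 < n)%N -> is_der D -> D (ccycle R e) = 0.
Proof.
move=> ve n_gt0 derD; set Z := ccycle R e; apply: contrapT => DZ0.
have ZG : inLG Z by exact: inLG_ccycle ve n_gt0.
have [y [w0 yw0]] : exists y w0, (D Z y) w0 <> 0.
  apply: contrapT => h; apply: DZ0; apply: bop_ext => y w.
  by apply: contrapT => yw; apply: h; exists y, w.
have w0C : inC v (prange w0).
  case: (boolP (inC v (prange w0))) => // w0C; case: yw0.
  rewrite -(der_cprojK ve derD ZG); last exact: (@cproj_cycle _ _ _ _ _ ve n_gt0).
  by rewrite bopE_M (cprojE ve) (negbTE w0C).
set c0 := cabs ((D Z y) w0); set M := ell2_norm (D Z y).
have c0_gt0 : 0 < c0.
  rewrite lt0r cabs_ge0 andbT; apply/eqP => /cabs_eq0; exact: yw0.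
have M0 : 0 <= M by exact: ell2_norm_ge0.
(* The ratio [b] is large enough that the term of degree [lac_exp b j] dominates
   the earlier ones, and that the gaps exceed the length of [w0]. *)
pose b := (2 + plen w0 + Num.bound (2 * M / c0))%N.
have b_gt1 : (1 < b)%N by rewrite /b; lia.
have bw0 : (plen w0 < b)%N by rewrite /b; lia.
have bM : 2 * M <= (b%:R - 1) * c0.
  have h : 0 <= 2 * M / c0 by rewrite divr_ge0 ?mulr_ge0// ltW.
  have := archi_boundP h; rewrite -ler_pdivrMr// => /ltW/le_trans; apply.
  by rewrite lerBrDr natr1 ler_nat /b; lia.
clearbody b; have b1 : 1 < b%:R :> R by rewrite ltr1n.
have [F [FG Flac]] := lac_series R ve n_gt0 b_gt1.
set K := ell2_norm (D F y).
have geo j : (b%:R - 1) * \sum_(i < j) b%:R ^+ i <= b%:R ^+ j :> R.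
  elim: j => [|j IHj]; first by rewrite big_ord0 mulr0 exprn_ge0.
  rewrite big_ord_recr /= mulrDr exprS; lra.
(* Compare coefficients at the path that extends [w0] by [lac_exp b j - 1] turns. *)
have main j : b%:R ^+ j * c0 <= 2 * K.
  pose w := iter (n * (lac_exp b j).-1) (tau v e) w0.
  have wlen : (plen w < n * (lac_exp b j.+1).-1)%N.
    rewrite (plen_iter_tau ve)//.
    have gap := lac_exp_gap b_gt1 j; have pos := lac_exp_gt0 b_gt1 j.
    apply: (@leq_trans (n * ((lac_exp b j).-1 + b))); last first.
      by rewrite leq_mul2l; apply/orP; right; lia.
    by rewrite mulnDr ltn_add2l (leq_trans bw0)// leq_pmull.
  have := der_lac_series ve n_gt0 b_gt1 derD y FG Flac wlen.
  rewrite (der_lac_sum ve n_gt0 b_gt1 derD) big_ord_recr /=.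
  have -> : ((Z ^+ (lac_exp b j).-1) (D Z y)) w = (D Z y) w0.
    by rewrite ccycleX /w -[X in iter X]addn0 (cshiftX_tau ve).
  set rest := \sum_(i < j) _ => Ew.
  have restM : cabs rest <= M * \sum_(i < j) b%:R ^+ i.
    rewrite /rest mulr_sumr; elim/big_ind2 : _ => [|r1 s1 r2 s2 h1 h2|i _].
    - by rewrite cabs0.
    - by apply: le_trans (cabsD _ _) _; exact: lerD.
    rewrite cabsM cabs_real ger0_norm ?exprn_ge0// mulrC ler_wpM2r ?exprn_ge0//.
    have kij : ((lac_exp b i).-1 <= (lac_exp b j).-1)%N.
      by have := lac_exp_mono b_gt1 (ltnW (ltn_ord i)); lia.
    rewrite ccycleX /w -(subnKC kij) mulnDr (cshiftX_tau ve)//.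
    exact: cabs_le_norm.
  have : cabs ((b%:R ^+ j)%:C * (D Z y) w0) <= K + M * \sum_(i < j) b%:R ^+ i.
    have -> : (b%:R ^+ j)%:C * (D Z y) w0 = (D F y) w - rest.
      by rewrite Ew addrAC subrr add0r.
    apply: le_trans (cabsD _ _) _; rewrite cabsN; apply: lerD => //.
    exact: cabs_le_norm.
  rewrite cabsM cabs_real ger0_norm ?exprn_ge0// -/c0 => h.
  have := geo j; have : 0 <= \sum_(i < j) b%:R ^+ i :> R.
    by apply: sumr_ge0 => i _; exact: exprn_ge0.
  move: h bM; set s := \sum_(i < j) _; set t := _ ^+ j => h1 h2 h3 h4.
  have h5 : 2 * M * s <= (b%:R - 1) * c0 * s by exact: ler_wpM2r.
  have h6 : c0 * ((b%:R - 1) * s) <= c0 * t by rewrite ler_wpM2l// ltW.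
  lra.
have h : 0 <= 2 * K / c0 by rewrite divr_ge0 ?mulr_ge0 ?ell2_norm_ge0// ltW.
have := archi_boundP h; set j := Num.bound _; clearbody j.
rewrite ltr_pdivrMr// => hj.
have jb : (j%:R : R) <= b%:R ^+ j by rewrite -natrX ler_nat ltnW// ltn_expl.
have := ler_wpM2r (ltW c0_gt0) jb; have := main j; lra.
Qed.

(** * Averaging over a circle *)

Section CircleAverage.
Variables (R : realType) (G : digraph) (n : nat).
Variables (v : 'I_n -> vertex G) (e : 'I_n -> edge G).
Hypothesis ve : circle_at v e.
Hypothesis n_gt0 : (0 < n)%N.
Local Notation H := (ell2 R (gpath G)).
Local Notation B := (bop R (gpath G)).
Local Notation inLG := (@inLG R G).
Local Notation LE := (@L_edge R G).
Local Notation LV := (@L_vertex R G).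
Local Notation inC := (inC v).
Local Notation P := (cproj R v).
Local Notation S := (cshift R e).
Local Notation S' := (cshift_adj R e).
Local Notation Z := (ccycle R e).
Local Notation diag := (@cdiag R G n v).
Local Notation index := ({ffun 'I_n -> bool} * 'I_n)%type.
Implicit Types (x y : H) (A C : B) (w : gpath G) (i j : 'I_n) (p : index).
Variable D : B -> B.
Hypothesis derD : is_der D.

Definition sgn (eps : {ffun 'I_n -> bool}) i : R[i] := (-1) ^+ eps i.

(** Up to powers of the central element [Z], the [cunit p] form a finite group
    of contractions that spans the algebra of the circle over its centre;
    [cunit' p] is [Z] times the inverse of [cunit p]. *)
Definition cunit p : B := diag (sgn p.1) * S ^+ p.2.
Definition cunit' p : B := S ^+ (n - p.2) * diag (sgn p.1).

Let dS a : S * diag a = diag (a \o @ordS n) * S. Proof. exact: cshift_diag ve a. Qed.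
Let dM a b : diag a * diag b = diag (fun i => a i * b i). Proof. exact: cdiagM ve a b. Qed.
Let dG a : inLG (diag a). Proof. exact: inLG_cdiag. Qed.
Let ZG : inLG Z. Proof. exact: inLG_ccycle ve n_gt0. Qed.
Let Zc A : inLG A -> Z * A = A * Z.
Proof. by move=> AG; rewrite (ccycle_central ve n_gt0 AG). Qed.
Let Pc A : inLG A -> P * A = A * P.
Proof. by move=> AG; rewrite (cproj_central ve AG). Qed.
Let DZ : D Z = 0. Proof. exact: der_ccycle ve n_gt0 derD. Qed.
Let PD a : P * diag a = diag a. Proof. exact: cprojD ve a. Qed.
Let DP a : diag a * P = diag a. Proof. exact: cdiagP ve a. Qed.
Let SG : inLG S. Proof. exact: inLG_cshift. Qed.

Lemma inLG_cunit p : inLG (cunit p).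
Proof.
rewrite /cunit -DP -mulrA; apply: inLGM => //.
exact: inLG_cshiftX.
Qed.

Lemma cunit'E p : cunit' p = S * (S ^+ (n - p.2).-1 * diag (sgn p.1)).
Proof. by rewrite mulrA -exprS prednK// subn_gt0. Qed.

Lemma inLG_cunit' p : inLG (cunit' p).
Proof.
rewrite cunit'E -PD (mulrA (S ^+ _)) -(cproj_shiftX R ve).
by do 2!apply: inLGM => //; exact: inLG_cshiftX.
Qed.

Lemma sgn_sq eps i : sgn eps i * sgn eps i = 1.
Proof. by rewrite /sgn -signr_addb addbb. Qed.

Lemma cunitK p : cunit p * cunit' p = Z.
Proof.
rewrite /cunit /cunit' mulrA -(mulrA (diag _)) -exprD subnKC ?(ltnW (ltn_ord _))//.
rewrite -/(ccycle R e) -Zc// -mulrA dM (_ : diag _ = P).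
  exact: (@ccycle_proj _ _ _ _ _ ve n_gt0).
by congr cdiag; apply/funext => i; exact: sgn_sq.
Qed.

Definition cavg : B := \sum_p D (cunit p) * cunit' p.

(** If left multiplication by [A] permutes the [cunit p], the average
    [cavg] intertwines up to the defect [D A]. *)
Lemma cavg_comm A (sigma : index -> index) : injective sigma -> inLG A ->
  (forall p, D (A * cunit p) * cunit' p = D (cunit (sigma p)) * cunit' (sigma p) * A) ->
  A * cavg - cavg * A = - (#|{: index}|%:R *: (D A * Z)).
Proof.
move=> inj AG hA; have -> : cavg * A = \sum_p D (A * cunit p) * cunit' p.
  by rewrite /cavg (reindex_inj inj) mulr_suml; apply: eq_bigr => p _; rewrite hA.
rewrite /cavg mulr_sumr -sumrB.
rewrite (eq_bigr (fun=> - (D A * Z))) => [|p _].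
  by rewrite sumr_const mulNrn scaler_nat.
rewrite (derM derD)//; last exact: (@inLG_cunit p).
by rewrite mulrDl -mulrA cunitK mulrA opprD addrCA subrr addr0.
Qed.

Lemma cavg_diag eta : diag (sgn eta) * cavg - cavg * diag (sgn eta) =
  - (#|{: index}|%:R *: (D (diag (sgn eta)) * Z)).
Proof.
pose sigma p : index := ([ffun i => p.1 i (+) eta i], p.2).
have sgnM eps : (fun i => sgn eta i * sgn eps i) = sgn [ffun i => eps i (+) eta i].
  by apply/funext => i; rewrite /sgn ffunE signr_addb mulrC.
apply: (cavg_comm (sigma := sigma)) => // [|p].
  move=> [eps i] [eps' i'] [/ffunP h ->]; congr (_, _).
  by apply/ffunP => k; have := h k; rewrite !ffunE => /addIb.
have -> : diag (sgn eta) * cunit p = cunit (sigma p).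
  by rewrite /cunit mulrA dM sgnM.
rewrite -[RHS]mulrA; congr (_ * _).
rewrite /cunit' -[RHS]mulrA dM /=; congr (_ * diag _); apply/funext => i.
by rewrite /sgn ffunE signr_addb -mulrA -signr_addb addbb mulr1.
Qed.

Lemma cavg_shift : S * cavg - cavg * S = - (#|{: index}|%:R *: (D S * Z)).
Proof.
pose sigma p : index := ([ffun i => p.1 (ordS i)], ordS p.2).
have sgnS eps : sgn eps \o @ordS n = sgn [ffun i => eps (ordS i)].
  by apply/funext => i; rewrite /sgn /= ffunE.
apply: (cavg_comm (sigma := sigma)) => // [|p].
  move=> [eps i] [eps' i'] ss; have h k := congr1 (fun s : index => s.1 k) ss.
  have -> : i = i' by exact: ordS_inj (congr1 snd ss).
  congr (_, _).
  apply/ffunP => k; have [l ->] := ordS_surj k.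
  by have := h l; rewrite !ffunE.
have -> : S * cunit p = diag (sgn (sigma p).1) * S ^+ p.2.+1.
  by rewrite /cunit mulrA dS sgnS -mulrA -exprS.
have [pn|pn] := ltnP p.2.+1 n.
  have -> : diag (sgn (sigma p).1) * S ^+ p.2.+1 = cunit (sigma p).
    by rewrite /cunit /= modn_small.
  rewrite -[RHS]mulrA; congr (_ * _).
  rewrite /cunit' /= modn_small// -[RHS]mulrA -sgnS -dS [RHS]mulrA -exprSr.
  by rewrite subnSK.
(* The power of the shift wraps around to [Z], which [D] kills. *)
have pn1 : p.2.+1 = n by apply/eqP; rewrite eqn_leq ltn_ord pn.
have s0 : (ordS p.2 : nat) = 0%N by rewrite /= pn1 modnn.
rewrite pn1 -/(ccycle R e) (derM derD)// DZ mulr0 addr0.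
rewrite /cunit /cunit' s0 expr0 mulr1 subn0 -/(ccycle R e).
have -> : (n - p.2)%N = 1%N by rewrite -{1}pn1 subSnn.
by rewrite expr1 dS sgnS -!mulrA.
Qed.

(** The commutator with [cgen] is [Z] times the derivation. *)
Definition cgen : B := - #|{: index}|%:R^-1 *: cavg.

Let card_neq0 : #|{: index}|%:R != 0 :> R[i].
Proof.
rewrite pnatr_eq0 -lt0n; apply/card_gt0P.
by exists ([ffun=> false], Ordinal n_gt0).
Qed.

Definition cimpl A : Prop := D A * Z = A * cgen - cgen * A.

Lemma cimpl_avg A : A * cavg - cavg * A = - (#|{: index}|%:R *: (D A * Z)) ->
  cimpl A.
Proof.
move=> h; rewrite /cimpl /cgen -bop_scaleAr -bop_scaleAl -scalerBr h scalerN scaleNr.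
by rewrite opprK scalerA mulVf// scale1r.
Qed.

Lemma cimpl_lin (c : R[i]) A C : inLG A -> inLG C -> cimpl A -> cimpl C ->
  cimpl (c *: A + C).
Proof.
move=> AG CG hA hC; rewrite /cimpl (der_lin derD)// !mulrDl mulrDr -bop_scaleAl hA hC.
by rewrite -(bop_scaleAl c A cgen) -(bop_scaleAr c cgen A) scalerBr opprD addrACA.
Qed.

Lemma cimplM A C : inLG A -> inLG C -> cimpl A -> cimpl C -> cimpl (A * C).
Proof.
move=> AG CG hA hC; rewrite /cimpl (derM derD)// mulrDl.
rewrite -(mulrA (D A)) -(Zc CG) (mulrA (D A)) hA -(mulrA A (D C)) hC.
by rewrite mulrBl mulrBr !mulrA addrC addrA subrK.
Qed.

(** A vertex projection is half the difference of the identity of the circle and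
    the diagonal matrix of signs with a single minus sign. *)
Lemma cimpl_vertex i : cimpl (LV (v i)).
Proof.
pose eta : {ffun 'I_n -> bool} := [ffun j => j == i].
have -> : LV (v i) = - 2^-1 *: diag (sgn eta) + 2^-1 *: diag (sgn [ffun=> false]) + 0.
  rewrite addr0 L_vertex_cdiag; apply: bop_ext => x w.
  rewrite bopE_D !bopE_Z ell2DE !ell2ZE.
  case: (boolP (inC (prange w))) => [/inCP[j wj]|wC].
    rewrite !(cdiagE ve _ _ wj) /sgn !ffunE expr0 !mulrA -mulrDl; congr (_ * _).
    case: (j == i); first by rewrite expr1 mulrNN mulr1 -[2^-1]mul1r -splitr.
    by rewrite expr0 !mulr1 addNr.
  by rewrite !cdiag0// !mulr0 addr0.
have d eps : cimpl (diag (sgn eps)) by apply: cimpl_avg; exact: cavg_diag.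
have c0 : cimpl 0 by rewrite /cimpl (der0 derD) !mul0r mulr0 subrr.
rewrite -addrA; apply: cimpl_lin => //.
  by apply: inLGD; [exact: inLGZ|exact: inLG0].
by apply: cimpl_lin => //; exact: inLG0.
Qed.

Lemma cimpl_edge i : cimpl (LE (e i)).
Proof.
rewrite (L_edge_cshift _ ve); apply: cimplM => //; first exact: inLG_vertex.
  exact: cimpl_vertex.
by apply: cimpl_avg; exact: cavg_shift.
Qed.

Lemma inLG_cgen : inLG cgen.
Proof.
apply: inLGZ; apply: inLG_sum => p; apply: inLGM; last exact: (@inLG_cunit' p).
by apply: der_inLG => //; exact: (@inLG_cunit p).
Qed.

Lemma cproj_cunit p : P * cunit p = cunit p.
Proof. by rewrite /cunit mulrA PD. Qed.

Lemma cproj_cgen : P * cgen = cgen.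
Proof.
rewrite /cgen -bop_scaleAr /cavg mulr_sumr; congr (_ *: _); apply: eq_bigr => p _.
rewrite mulrA (der_cprojK ve derD)//; first exact: (@inLG_cunit p).
exact: cproj_cunit.
Qed.

(** The entries of [cgen] of degree less than [n] vanish: in degree zero by
    construction, and in positive degree because they link two different
    vertices and are therefore visible in a commutator with a vertex
    projection, which is divisible by [Z]. *)
Lemma cgen_short k i : (k < n)%N -> chi (v i) (S' ^+ k * cgen) = 0.
Proof.
case: k => [_|k kn].
  rewrite expr0 mul1r /chi /cgen bopE_Z ell2ZE /cavg bopE_sum ell2_sumE.
  rewrite big1 ?mulr0// => p _; rewrite -/(chi _ _) chiM; last first.
    by apply: der_inLG => //; exact: (@inLG_cunit p).
  by rewrite [chi _ (cunit' p)]/chi cunit'E bopE_M cshift_vpath mulr0.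
rewrite (chi_cshift_adjX ve); have [j jv ji] := prange_iter_tau ve k.+1 i.
set w := iter _ _ _ in jv *.
have wn : (plen w < n)%N.
  by rewrite (plen_iter_tau ve) ?prange_vpath ?inC_v// addn0.
have ij : v i != v j.
  case: (ve) => v_inj _ _ _ _; rewrite (inj_eq v_inj); apply/eqP => eij.
  move: (congr1 val ji); rewrite iter_ordS eij /=.
  have [h|h] := ltnP (j + k.+1) n; first by rewrite modn_small//; lia.
  by rewrite -(subnK h) modnDr modn_small; have := ltn_ord j; lia.
have := congr1 (fun A => (A (xi R (vpath (v i)))) w) (cimpl_vertex j).
rewrite -Zc; last by apply: der_inLG => //; exact: inLG_vertex.
have -> : ((Z * D (LV (v j))) (xi R (vpath (v i)))) w = 0.
  by rewrite bopE_M; exact: (cshiftX_short ve _ wn).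
rewrite bopE_B ell2BE !bopE_M L_vertexE jv eqxx L_vertex_xi prange_vpath.
by rewrite (negbTE ij) bop_apply0 ell2_0E subr0 => <-.
Qed.

(** The quotient of [cgen] by [Z = S ^+ n]. *)
Definition cimplementer : B := S' ^+ n * cgen.

Lemma cimplementerP :
  [/\ inLG cimplementer, Z * cimplementer = cgen & P * cimplementer = cimplementer].
Proof.
have [k i kn|TG ZT PT] := cshift_divXK ve (N := n) inLG_cgen cproj_cgen.
  exact: cgen_short.
by split.
Qed.

Lemma der_implementer A : inLG A -> P * A = A -> cimpl A ->
  D A = A * cimplementer - cimplementer * A.
Proof.
move=> AG PA; rewrite /cimpl => hA; have [TG ZT PT] := cimplementerP.
move: cimplementer cgen TG ZT PT hA => T X TG ZT PT hA.
have cancel C : P * C = C -> C = S' ^+ n * (Z * C).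
  by move=> PC; rewrite -{1}PC -(cshift_adjXK R ve n) -!mulrA PC.
set U := A * T - T * A.
have PU : P * U = U.
  by rewrite /U mulrBr !mulrA PA PT.
have ZU : Z * D A = Z * U.
  rewrite /U mulrBr !mulrA ZT (Zc AG) -(mulrA A) ZT -hA.
  by rewrite Zc//; exact: der_inLG.
by rewrite (cancel (D A)) ?(der_cprojK ve derD)// (cancel U)// ZU.
Qed.

Lemma cunit_norm p x : ell2_norm (cunit p x) <= ell2_norm x.
Proof.
rewrite bopE_M; apply: le_trans (cdiag_norm ve _ _) (cshiftX_norm ve _ _) => i.
by rewrite /sgn /cabs normrX normrN1 expr1n.
Qed.

Lemma cunit'_norm p x : ell2_norm (cunit' p x) <= ell2_norm x.
Proof.
rewrite bopE_M; apply: le_trans (cshiftX_norm ve _ _) (cdiag_norm ve _ _) => i.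
by rewrite /sgn /cabs normrX normrN1 expr1n.
Qed.

(** Division by the isometry [S ^+ n] and multiplication by the contractions
    [cunit' p] do not increase the norm of an average. *)
Lemma cimplementer_norm (K : R) : 0 <= K ->
  (forall p y, ell2_norm (D (cunit p) y) <= K * ell2_norm y) ->
  forall y, ell2_norm (cimplementer y) <= K * ell2_norm y.
Proof.
move=> K0 DK y; rewrite /cimplementer bopE_M.
apply: le_trans (cshift_adjX_norm ve _ _) _.
rewrite /cgen bopE_Z ell2_normZE cabsN.
have N_gt0 : 0 < #|{: index}|%:R :> R.
  by move: card_neq0; rewrite !pnatr_eq0 ltr0n lt0n.
have -> : (#|{: index}|%:R^-1 : R[i]) = (#|{: index}|%:R^-1 : R)%:C.
  by rewrite fmorphV rmorph_nat.
rewrite cabs_real ger0_norm ?invr_ge0 ?ler0n// ler_pdivrMl//.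
rewrite /cavg bopE_sum; apply: le_trans (ell2_norm_sum _ _) _.
rewrite mulr_natl -sumr_const; apply: ler_sum => p _.
rewrite bopE_M; apply: le_trans (DK _ _) _.
by rewrite ler_wpM2l// cunit'_norm.
Qed.

End CircleAverage.

(** * Operator norms *)

Section OperatorNorm.
Variables (R : realType) (I : choiceType).
Local Notation B := (bop R I).
Implicit Types (A : B) (K : R).

Lemma opnorm_le A K : 0 <= K -> (forall y, ell2_norm (A y) <= K * ell2_norm y) ->
  (opnorm A <= K%:E)%E.
Proof.
move=> K0 AK; apply: ge_ereal_sup => _ [y /= y1 <-]; rewrite lee_fin.
by apply: le_trans (AK y) _; rewrite ler_piMr.
Qed.

Definition bnorm A : R := fine (opnorm A).

Lemma opnorm_ge0 A : (0 <= opnorm A)%E.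
Proof.
apply: ereal_sup_ubound; exists 0 => /=; first by rewrite ell2_norm0.
by rewrite bop_apply0 ell2_norm0.
Qed.

Lemma bnormE A : (bnorm A)%:E = opnorm A.
Proof.
have [_ [M M0 AM]] := bounded_operatorP (valP A).
rewrite /bnorm fineK// ge0_fin_numE ?opnorm_ge0//.
by apply: le_lt_trans (opnorm_le M0 AM) _; rewrite ltry.
Qed.

Lemma bnorm_ge0 A : 0 <= bnorm A.
Proof. by rewrite -lee_fin bnormE opnorm_ge0. Qed.

Lemma bnorm_ub A y : ell2_norm (A y) <= bnorm A * ell2_norm y.
Proof.
have [y0|y0] := eqVneq (ell2_norm y) 0.
  have [_ [M M0 AM]] := bounded_operatorP (valP A).
  by have := AM y; rewrite y0 !mulr0.
have ny0 : 0 < ell2_norm y by rewrite lt0r y0 ell2_norm_ge0.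
pose u := (ell2_norm y)^-1%:C *: y.
have : ((ell2_norm (A u))%:E <= opnorm A)%E.
  apply: ereal_sup_ubound; exists u => //=.
  by rewrite ell2_normZE cabs_real ger0_norm ?invr_ge0 ?(ltW ny0)// mulVf.
rewrite -bnormE lee_fin bop_applyZ ell2_normZE cabs_real ger0_norm ?invr_ge0 ?(ltW ny0)//.
by rewrite ler_pdivrMl// mulrC.
Qed.

Lemma bnorm_le A K : 0 <= K -> (forall y, ell2_norm (A y) <= K * ell2_norm y) ->
  bnorm A <= K.
Proof. by move=> K0 AK; rewrite -lee_fin bnormE opnorm_le. Qed.

End OperatorNorm.

(** * Derivations on a component *)

(** Since the bound on the implementer involves finitely many operators, it can be
    expressed through a single one; this is what makes it possible to treat all
    components at once later. *)
Lemma circle_implementer (R : realType) (G : digraph) (n : nat)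
    (v : 'I_n -> vertex G) (e : 'I_n -> edge G)
    (D : bop R (gpath G) -> bop R (gpath G)) :
  circle_at v e -> (0 < n)%N -> is_der D ->
  exists T W, [/\ inLG T, cproj R v * T = T,
      (forall i, D (L_vertex R (v i)) = L_vertex R (v i) * T - T * L_vertex R (v i)) &
      (forall i, D (L_edge R (e i)) = L_edge R (e i) * T - T * L_edge R (e i))] /\
    [/\ inLG W, cproj R v * W = W, (forall y, ell2_norm (W y) <= ell2_norm y) &
      forall y, ell2_norm (T y) <= bnorm (D W) * ell2_norm y].
Proof.
move=> ve n_gt0 derD.
pose p0 := ([ffun=> false] : {ffun 'I_n -> bool}, Ordinal n_gt0).
pose F p := bnorm (D (cunit R v e p)).
have [p _ pmax] := @Order.TotalTheory.arg_maxP _ _ _ p0 xpredT F isT.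
have [TG _ PT] := cimplementerP ve n_gt0 derD.
exists (cimplementer v e D), (cunit R v e p); split; split => //.
- move=> i; apply: (der_implementer ve n_gt0 derD) => //.
  + exact: inLG_vertex.
  + by rewrite (cproj_vertex _ ve) inC_v scale1r.
  + exact: cimpl_vertex.
- move=> i; apply: (der_implementer ve n_gt0 derD) => //.
  + exact: inLG_edge.
  + by case: (ve) => _ rng_e _ _ _; rewrite (cproj_edge _ ve) rng_e inC_v scale1r.
  + exact: cimpl_edge.
- exact: inLG_cunit.
- exact: cproj_cunit.
- exact: cunit_norm.

apply: (cimplementer_norm ve n_gt0 (bnorm_ge0 _)) => q y.
apply: le_trans (bnorm_ub _ _) _; apply: ler_wpM2r; first exact: ell2_norm_ge0.
exact: pmax.
Qed.

Lemma circle_of_component (G : digraph) (x : vertex G) (n : nat) :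
  digraph_iso (graph_component x) (circle_graph n) ->
  exists (v : 'I_n -> vertex G) (e : 'I_n -> edge G),
    circle_at v e /\ forall y, graph_connected x y <-> inC v y.
Proof.
move=> [f [g [[f' fK f'K] [g' gK g'K] srcE rngE]]].
pose v i : vertex G := val (f' i); pose e i : edge G := val (g' i).
have v_conn i : graph_connected x (v i) := set_mem (valP (f' i)).
have rng_e i : rng (e i) = v i.
  rewrite /v -(_ : rng (g' i) = f' i)//; apply: (can_inj fK).
  by rewrite f'K -rngE g'K.
have src_e i : src (e i) = v (ordS i).
  rewrite /v -(_ : src (g' i) = f' (ordS i))//; apply: (can_inj fK).
  by rewrite f'K -srcE g'K.
have v_inj : injective v.
  by move=> i j /val_inj; exact: (can_inj f'K).
have edge_in h : graph_connected x (src h) -> graph_connected x (rng h) ->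
    exists a : edge (graph_component x), val a = h.
  move=> hs hr; have hin : h \in induced_edges [set y | graph_connected x y].
    by apply: mem_set; split.
  by exists (SigSub hin : induced_edges _).
have adj h : graph_connected (src h) (rng h) by apply: rst_step; exists h.
have valrng (a : edge (graph_component x)) : val (rng a) = rng (val a) by [].
have valsrc (a : edge (graph_component x)) : val (src a) = src (val a) by [].
have g'E (a : edge (graph_component x)) : val a = e (g a) by rewrite /e gK.
exists v, e; split; first split => //.
- move=> h i hi; have hr : graph_connected x (rng h) by rewrite hi.
  have hs : graph_connected x (src h) by apply: rst_trans hr _; exact/rst_sym/adj.
  have [a ah] := edge_in h hs hr; rewrite -ah g'E; congr e; apply: v_inj.
  by rewrite -rng_e -g'E ah.
- move=> h i hi; have hs : graph_connected x (src h) by rewrite hi.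
  have hr : graph_connected x (rng h) by apply: rst_trans hs _; exact: adj.
  have [a ah] := edge_in h hs hr; rewrite -ah g'E; congr e.
  by apply/(@ordS_inj n)/v_inj; rewrite -src_e -g'E ah.
move=> y; split=> [xy|/inCP[i ->]]; last exact: v_conn.
have yin : y \in [set z | graph_connected x z] by exact: mem_set.
apply/inCP; exists (f (SigSub yin : [set z | graph_connected x z])).
by rewrite /v fK.
Qed.

(** * Direct sums over the components *)

Section DirectSum.
Variables (R : realType) (G : digraph).
Hypothesis hG : circle_components G.
Local Notation H := (ell2 R (gpath G)).
Local Notation B := (bop R (gpath G)).
Local Notation inLG := (@inLG R G).
Local Notation V := (vertex G).
Implicit Types (x y : V).

Lemma conn_refl x : graph_connected x x. Proof. exact: rst_refl. Qed.
Lemma conn_sym x y : graph_connected x y -> graph_connected y x.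
Proof. exact: rst_sym. Qed.
Lemma conn_trans x y z : graph_connected x y -> graph_connected y z ->
  graph_connected x z.
Proof. exact: rst_trans. Qed.

(** [xget] only depends on the predicate when it is satisfiable, so connected
    vertices get the same representative. *)
Definition rep x : V := xget x (graph_connected x).

Lemma rep_conn x : graph_connected x (rep x).
Proof. exact: (xgetI x (conn_refl x)). Qed.

Lemma rep_eq x y : graph_connected x y -> rep x = rep y.
Proof.
move=> xy; rewrite /rep; have -> : graph_connected y = graph_connected x.
  apply/funext => z; apply/propext; split; first exact: conn_trans.
  exact/conn_trans/conn_sym.
rewrite /xget; case: pselect => // -[]; exists x; exact/asboolP/conn_refl.
Qed.

Lemma repK x : rep (rep x) = rep x.
Proof. exact/esym/rep_eq/rep_conn. Qed.

Lemma rep_connE x y : rep x = x -> graph_connected x y <-> rep y = x.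
Proof.
move=> rx; split=> [/rep_eq <-//|<-]; exact/conn_sym/rep_conn.
Qed.

Definition circle_proj x (P : B) : Prop :=
  exists n (v : 'I_n -> V) (e : 'I_n -> edge G), [/\ circle_at v e, (0 < n)%N,
    P = cproj R v & forall y, graph_connected x y <-> inC v y].

Lemma circle_proj_ex x : exists P, circle_proj x P.
Proof.
have [n n0 iso] := hG x; have [v [e [ve vC]]] := circle_of_component iso.
by exists (cproj R v), n, v, e.
Qed.

Definition comp_proj x : B := projT1 (cid (circle_proj_ex x)).

Lemma comp_projP x : circle_proj x (comp_proj x).
Proof. exact: projT2 (cid (circle_proj_ex x)). Qed.

Lemma inLG_comp_proj x : inLG (comp_proj x).
Proof. by have [n [v [e [_ _ -> _]]]] := comp_projP x; exact: inLG_cproj. Qed.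

Lemma comp_proj_central x A : inLG A -> comp_proj x * A = A * comp_proj x.
Proof.
have [n [v [e [ve _ -> _]]]] := comp_projP x => AG.
by rewrite (cproj_central ve AG).
Qed.

Lemma comp_projE x z w : (comp_proj x z) w =
  if `[< graph_connected x (prange w) >] then z w else 0.
Proof.
have [n [v [e [ve _ -> xC]]]] := comp_projP x; rewrite (cprojE ve).
by congr (if _ then _ else _); apply/idP/asboolP => /xC.
Qed.

Lemma comp_projE_rep x z w : rep x = x ->
  (comp_proj x z) w = if rep (prange w) == x then z w else 0.
Proof.
move=> rx; rewrite comp_projE; congr (if _ then _ else _).
by apply/asboolP/eqP => /(rep_connE _ rx).
Qed.

Lemma comp_proj_norm x z : ell2_norm (comp_proj x z) <= ell2_norm z.
Proof.
apply: ell2_norm_le_pointwise => w; rewrite comp_projE.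
by case: ifP => // _; rewrite cabs0 cabs_ge0.
Qed.

Definition reps (F : {fset V}) : seq V := [seq x <- F | rep x == x].

Lemma reps_uniq F : uniq (reps F). Proof. exact/filter_uniq/fset_uniq. Qed.

(** Distinct representatives belong to distinct components, which leaves at most
    one non-zero term at any given path. *)
Lemma sum_reps (U : nmodType) F (f : V -> U) x :
  (forall y, y != x -> f y = 0) ->
  \sum_(y <- reps F) f y = if x \in reps F then f x else 0.
Proof.
move=> fx; case: ifPn => xF.
  by rewrite (bigD1_seq x) ?reps_uniq//= big1 ?addr0// => y; exact: fx.
rewrite big_seq big1// => y yF; apply: fx; apply: contraNneq xF => <-.
exact: yF.
Qed.

Lemma mem_reps F x : x \in reps F -> rep x = x.
Proof. by rewrite mem_filter => /andP[/eqP]. Qed.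

Variable A_ : V -> B.
Hypothesis A_G : forall x, inLG (A_ x).

Definition partial_dsum F : B := \sum_(x <- reps F) comp_proj x * A_ x.

Lemma partial_dsumE F z w : (partial_dsum F z) w =
  if rep (prange w) \in reps F then (A_ (rep (prange w)) z) w else 0.
Proof.
rewrite /partial_dsum bopE_sum ell2_sumE.
have E y : y \in reps F -> ((comp_proj y * A_ y) z) w =
    if rep (prange w) == y then (A_ y z) w else 0.
  by move=> /mem_reps ry; rewrite bopE_M comp_projE_rep.
rewrite big_seq (eq_bigr _ E) -big_seq (@sum_reps _ _ _ (rep (prange w))).
  by rewrite eqxx.
by move=> y; rewrite eq_sym => /negbTE ->.
Qed.

Variable K : R.
Hypothesis K0 : 0 <= K.
Hypothesis A_K : forall x z, ell2_norm (A_ x z) <= K * ell2_norm z.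

(** Central projections onto the components are mutually orthogonal, and the
    squares of the norms add up. *)
Lemma partial_dsum_norm F z : ell2_norm (partial_dsum F z) <= K * ell2_norm z.
Proof.
rewrite -(@ler_pXn2r _ 2)// ?nnegrE ?mulr_ge0 ?ell2_norm_ge0//.
rewrite -lee_fin ell2_normE exprMn EFinM ell2_normE.
have sq0 w (u : H) : (0 <= (cabs (u w) ^+ 2)%:E)%E by rewrite lee_fin sqr_ge0.
have AP x : x \in reps F -> comp_proj x (A_ x z) = A_ x (comp_proj x z).
  by move=> _; rewrite -!bopE_M comp_proj_central.
have split1 : sqnorm (partial_dsum F z) =
    (\sum_(x <- reps F) sqnorm (comp_proj x (A_ x z)))%E.
  rewrite /sqnorm -esum_sum => [|w x _ _]; last exact: sq0.
  apply: eq_esum => w _; rewrite partial_dsumE.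
  rewrite big_seq (eq_bigr (fun x => if rep (prange w) == x then
    (cabs ((A_ x z) w) ^+ 2)%:E else 0%E)).
    rewrite -big_seq (@sum_reps _ _ _ (rep (prange w))).
      by rewrite eqxx; case: ifP => // _; rewrite cabs0 expr0n.
    by move=> y; rewrite eq_sym => /negbTE ->.
  move=> x /mem_reps rx; rewrite comp_projE_rep//.
  by case: ifP => // _; rewrite cabs0 expr0n.
rewrite split1.
apply: (@le_trans _ _ (\sum_(x <- reps F) (K ^+ 2)%:E * sqnorm (comp_proj x z))%E).
  rewrite !big_seq; apply: lee_sum => x xF; rewrite AP// -!ell2_normE -EFinM lee_fin.
  by rewrite -exprMn ler_pXn2r ?nnegrE ?mulr_ge0 ?ell2_norm_ge0.
rewrite -ge0_sume_distrr; last by move=> x _; exact: sqnorm_ge0.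
apply: lee_wpmul2l; first by rewrite lee_fin sqr_ge0.
rewrite /sqnorm -esum_sum => [|w x _ _]; last exact: sq0.
apply: le_esum => w _.
rewrite big_seq (eq_bigr (fun x => if rep (prange w) == x then
  (cabs (z w) ^+ 2)%:E else 0%E)).
  rewrite -big_seq (@sum_reps _ _ _ (rep (prange w))).
    by rewrite eqxx; case: ifP => // _; exact: sq0.
  by move=> y; rewrite eq_sym => /negbTE ->.
move=> x /mem_reps rx; rewrite comp_projE_rep//.
by case: ifP => // _; rewrite cabs0 expr0n.
Qed.

(** The finite partial sums are bounded by [K] and their coordinates are eventually
    constant, whatever the number of components. *)
Lemma inLG_dsum : exists D : B, [/\ inLG D,
  forall x, rep x = x -> comp_proj x * D = comp_proj x * A_ x &
  forall z, ell2_norm (D z) <= K * ell2_norm z].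
Proof.
have FF := @summability.totally_filter V.
have FG F : inLG (partial_dsum F).
  by apply: inLG_sum => x; apply: inLGM => //; exact: inLG_comp_proj.
have [z w|D [DG DE DK]] := @inLG_limit R G _ summability.totally FF partial_dsum K
  (fun z w => (A_ (rep (prange w)) z) w) K0 FG partial_dsum_norm.
  exists [fset rep (prange w)]%fset => // F /= wF.
  rewrite partial_dsumE mem_filter repK eqxx.
  by rewrite (fsubsetP wF) ?inE.
exists D; split => // x rx; apply: bop_ext => z w.
rewrite !bopE_M !comp_projE_rep//; case: eqP => // wx.
by rewrite DE wx.
Qed.

End DirectSum.

(** * The implementation theorem *)

Section Extension.
Variables (R : realType) (G : digraph).
Local Notation B := (bop R (gpath G)).
Local Notation inLG := (@inLG R G).
Implicit Types (A : B).

(** Extending by zero gives access to the ring structure of the bounded operators. *)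
Definition extend (d : LG R G -> LG R G) (A : B) : B :=
  if insub A is Some a then val (d a) else 0.

Lemma extendE d (a : LG R G) : extend d (val a) = val (d a).
Proof. by rewrite /extend valK. Qed.

Lemma inLG_val (a : LG R G) : inLG (val a).
Proof. by have := valP a; rewrite unfold_in inE. Qed.

Lemma inLG_lift A : inLG A -> exists a : LG R G, val a = A.
Proof.
move=> AG; have h : A \in @LG_pred R G by rewrite unfold_in inE.
by exists (MkLG h).
Qed.

Lemma extend_der d : derivation d -> is_der (extend d).
Proof.
move=> [dlin dM]; split.
- by move=> A /inLG_lift[a <-]; rewrite extendE; exact: inLG_val.
- move=> c A C /inLG_lift[a <-] /inLG_lift[b <-].
  rewrite -[c *: val a + val b]/(val (c *: a + b)) !extendE dlin.
  by [].
- move=> A C /inLG_lift[a <-] /inLG_lift[b <-].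
  by rewrite -[val a * val b]/(val (LGmul a b)) !extendE dM.
Qed.

End Extension.

Lemma component_implementer (R : realType) (G : digraph) (hG : circle_components G)
    (D : bop R (gpath G) -> bop R (gpath G)) (derD : is_der D) (x : vertex G) :
  exists TW : bop R (gpath G) * bop R (gpath G),
  [/\ inLG TW.1, comp_proj R hG x * TW.1 = TW.1,
    (forall u, graph_connected x u ->
      D (L_vertex R u) = L_vertex R u * TW.1 - TW.1 * L_vertex R u) &
    (forall f, graph_connected x (rng f) ->
      D (L_edge R f) = L_edge R f * TW.1 - TW.1 * L_edge R f)] /\
  [/\ inLG TW.2, comp_proj R hG x * TW.2 = TW.2,
    (forall y, ell2_norm (TW.2 y) <= ell2_norm y) &
    forall y, ell2_norm (TW.1 y) <= bnorm (D TW.2) * ell2_norm y].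
Proof.
have [n [v [e [ve n_gt0 -> xC]]]] := comp_projP R hG x.
have [T [W [[TG PT DV DE] [WG PW W1 TW]]]] := circle_implementer ve n_gt0 derD.
exists (T, W); split; split => //=.
- by move=> u /xC/inCP[i ->].
- by move=> f /xC/(inC_rng ve)[i ->].
Qed.

Theorem proposition5p14 (R : realType) (G : digraph)
    (hG : circle_components G)
    (d : LG R G -> LG R G) (hd : derivation d) :
  exists2 T : LG R G, d = inner_derivation T & (opnorm T <= map_norm d)%E.
Proof.
pose D := extend d; have derD : is_der D := extend_der hd.
have [TW TWP] := choice (component_implementer hG derD).
(* One contraction [W] whose image controls the implementers of all components. *)
have [W [WG PW W1]] : exists W, [/\ inLG W,
    forall x, rep x = x -> comp_proj R hG x * W = (TW x).2 &
    forall y, ell2_norm (W y) <= ell2_norm y].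
  have [|||W [WG PW W1]] := @inLG_dsum R G hG (fun x => (TW x).2) _ 1.
  - by move=> x; have [_ []] := TWP x.
  - exact: ler01.
  - by move=> x z; have [_ [_ _ + _]] := TWP x; rewrite mul1r; apply.
  exists W; split => // [x rx|y]; last by rewrite -[leRHS]mul1r.
  by rewrite PW//; have [_ []] := TWP x.
pose K := bnorm (D W).
have TK x y : rep x = x -> ell2_norm ((TW x).1 y) <= K * ell2_norm y.
  move=> rx; have [_ [_ _ _ h]] := TWP x; apply: le_trans (h y) _.
  apply: ler_wpM2r; first exact: ell2_norm_ge0.
  apply: bnorm_le => [|z]; first exact: bnorm_ge0.
  have [n [v [e [ve n_gt0 Pv xC]]]] := comp_projP R hG x.
  rewrite -(PW x rx) Pv (der_cproj ve derD WG) -Pv bopE_M.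
  apply: le_trans (comp_proj_norm _ _ _) _; exact: bnorm_ub.
have [|||T [TG PT Tn]] := @inLG_dsum R G hG (fun x => (TW (rep x)).1) _ K.
- by move=> x; have [[]] := TWP (rep x).
- exact: bnorm_ge0.
- by move=> x z; apply: TK; exact: repK.
have PT' x : rep x = x -> comp_proj R hG x * T = (TW x).1.
  by move=> rx; rewrite PT// rx; have [[]] := TWP x.
have genE g x : rep x = x -> inLG g -> comp_proj R hG x * g = g ->
    D g = g * (TW x).1 - (TW x).1 * g -> D g = g * T - T * g.
  move=> rx gG Pg ->; rewrite -(PT' x rx) mulrA -(comp_proj_central hG x gG) Pg.
  by rewrite (comp_proj_central hG x TG) -mulrA Pg.
have DV u : D (L_vertex R u) = L_vertex R u * T - T * L_vertex R u.
  have ru := conn_sym (rep_conn u); apply: (genE _ (rep u) (repK u)).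
  - exact: inLG_vertex.
  - apply: bop_ext => y w; rewrite bopE_M comp_projE_rep ?repK// L_vertexE.
    by case: (eqVneq (prange w) u) => [->|_]; rewrite ?eqxx ?if_same.
  - by have [[_ _ h _] _] := TWP (rep u); exact: h.
have DE f : D (L_edge R f) = L_edge R f * T - T * L_edge R f.
  have ru := conn_sym (rep_conn (rng f)); apply: (genE _ (rep (rng f)) (repK _)).
  - exact: inLG_edge.
  - apply: bop_ext => y w; rewrite bopE_M comp_projE_rep ?repK//.
    elim/gpath_ind: w => [u|f' w fw _]; first by rewrite L_edge_vpath if_same.
    rewrite L_edge_econs prange_econs.
    by case: (eqVneq f' f) => [->|_]; rewrite ?eqxx ?if_same.
  - by have [[_ _ _ h] _] := TWP (rep (rng f)); exact: h.
have rng_inj : injective (@rng G).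
  move=> f f' ff'; have [n [v [e [ve n_gt0 Pv xC]]]] := comp_projP R hG (rng f).
  have /inCP[i fi] : inC v (rng f) by apply/xC; exact: conn_refl.
  by case: ve => _ _ _ h _; rewrite (h f i fi); apply/esym/h; rewrite -ff'.
have rng_surj (u : vertex G) : exists f, rng f = u.
  have [n [v [e [ve n_gt0 Pv xC]]]] := comp_projP R hG u.
  have /inCP[i ui] : inC v u by apply/xC; exact: conn_refl.
  by case: ve => _ h _ _ _; exists (e i); rewrite h.
pose D' A := D A - (A * T - T * A).
have derD' : is_der D'.
  split.
  - move=> A AG; apply: inLGB; first exact: der_inLG.
    by apply: inLGB; exact: inLGM.
  - move=> a A C AG CG; rewrite /D' (der_lin derD)// mulrDl mulrDr.
    rewrite -(bop_scaleAl a A T) -(bop_scaleAr a T A).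
    have subDD (p q r s : bop R (gpath G)) : p + q - (r + s) = p - r + (q - s).
      by rewrite opprD addrACA.
    by rewrite [X in _ - X]subDD subDD -!scalerBr.
  - move=> A C AG CG; rewrite /D' (derM derD)// mulrBl mulrBr addrACA.
    congr (_ + _); rewrite -opprD; congr (- _).
    by rewrite mulrBl mulrBr !mulrA [RHS]addrC addrA subrK.
have D'0 A : inLG A -> D A = A * T - T * A.
  move=> AG; apply/eqP; rewrite -subr_eq0; apply/eqP.
  apply: (is_der_eq0 rng_inj rng_surj derD') => // [f|u].
    by rewrite /D' DE subrr.
  by rewrite /D' DV subrr.
have [t tT] := inLG_lift TG; exists t.
  apply/funext => a; apply: val_inj; rewrite -extendE -/D D'0; last exact: inLG_val.
  by rewrite -tT.
rewrite -[X in opnorm X]/(val t) tT.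
have [w wW] := inLG_lift WG.
apply: (@le_trans _ _ (opnorm (d w))); last first.
  apply: ereal_sup_ubound; exists w => //=; rewrite -[X in opnorm X]/(val w) wW.
  by apply: opnorm_le => // y; rewrite mul1r.
apply: le_trans (opnorm_le (bnorm_ge0 _) Tn) _.
by rewrite bnormE /D -wW extendE.
Qed.
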